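(* Let $n\ge 2$ and let $S\subset[0,\pi]$ be a given countable set of angles. There exists a compact set $E\subset\mathbb{R}^n$ of Hausdorff dimension $n/8$ such that $E$ does not contain three distinct points forming an angle $\alpha\in S$. Moreover, $E$ does not contain four distinct points $x,y,z,v$ such that the directions $x-y$ and $z-v$ form an angle $\alpha\in S$.
   Context: Three distinct points $x,y,z\in\mathbb{R}^n$ form the angle $\alpha$ if, for some labelling of them, the angle $\angle yxz\in[0,\pi]$ at the vertex $x$ between the vectors $y-x$ and $z-x$ equals $\alpha$. For $x\ne y$ and $z\ne v$, the directions $x-y$ and $z-v$ form the angle $\alpha\in[0,\pi]$ given by $\cos\alpha=\frac{\langle x-y,z-v\rangle}{|x-y||z-v|}$. *)

(* Defs.v *)
From HB Require Import structures.
From mathcomp Require Import all_boot all_order all_algebra.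
From mathcomp Require Import all_classical all_reals all_analysis.
Set Implicit Arguments.
Unset Strict Implicit.
Unset Printing Implicit Defensive.
Import Order.TTheory GRing.Theory Num.Theory.
Local Open Scope classical_set_scope.
Local Open Scope ring_scope.

(* R^n is 'rV[R]_n. The library norm on 'rV[R]_n is the sup norm, so the
   Euclidean structure is introduced here; both induce the same topology. *)

Definition dotr (R : realType) (n : nat) (u v : 'rV[R]_n) : R :=
  \sum_(i < n) u ord0 i * v ord0 i.

Definition enorm (R : realType) (n : nat) (u : 'rV[R]_n) : R :=
  Num.sqrt (dotr u u).

(* Meaningful for nonzero u and v only. *)
Definition vectors_form_angle (R : realType) (n : nat) (u v : 'rV[R]_n)
    (a : R) : Prop :=
  0 <= a <= pi /\ cos a = dotr u v / (enorm u * enorm v).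

Definition points_form_angle (R : realType) (n : nat) (x y z : 'rV[R]_n)
    (a : R) : Prop :=
  [\/ vectors_form_angle (y - x) (z - x) a,
      vectors_form_angle (x - y) (z - y) a
    | vectors_form_angle (x - z) (y - z) a].

Local Open Scope ereal_scope.

(* The max gives the empty set diameter 0, its supremum being -oo. *)
Definition ediam (R : realType) (n : nat) (A : set 'rV[R]_n) : \bar R :=
  maxe 0 (ereal_sup [set (enorm (x - y)%R)%:E | x in A & y in A]).

(* The empty set has weight 0 also for s = 0, where 0 `^ 0 = 1. *)
Definition hausdorff_weight (R : realType) (n : nat) (s : R)
    (A : set 'rV[R]_n) : \bar R :=
  if A == set0 then 0 else ediam A `^ s.

Definition hausdorff_premeasure (R : realType) (n : nat) (s delta : R)
    (A : set 'rV[R]_n) : \bar R :=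
  ereal_inf [set \sum_(k <oo) hausdorff_weight s (U k) |
    U in [set U : nat -> set 'rV[R]_n |
      A `<=` \bigcup_k U k /\ forall k, ediam (U k) <= delta%:E]].

Definition hausdorff_measure (R : realType) (n : nat) (s : R)
    (A : set 'rV[R]_n) : \bar R :=
  ereal_sup [set hausdorff_premeasure s delta A |
    delta in [set delta : R | (0 < delta)%R]].

Definition hausdorff_dim (R : realType) (n : nat) (A : set 'rV[R]_n) :
    \bar R :=
  ereal_inf [set s%:E |
    s in [set s : R | (0 <= s)%R /\ hausdorff_measure s A = 0]].

(* Main.v *)
(* For lattice points with coordinates in Z / N the quantity
   F_t(u, w) = <u, w>^2 - t |u|^2 |w|^2, with t the squared cosine of a given
   angle, equals N^-4 (P - t Q) for integers P, Q of size O(N^4).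
   - If t is irrational, then for infinitely many N (powers of 2) one has
     |P - t Q| >= c N^-4 whenever Q <> 0: otherwise the offending fractions P/Q
     at consecutive scales would coincide, and t would be rational. So F_t is
     at least c N^-8 on lattice vectors.
   - If t is rational, a nonzero value of F_t at lattice vectors is at least
     c N^-4, and a zero is destroyed by translating by N^-5, along a coordinate
     in which F_t has nonzero derivative, only those lattice points that lie in
     a ball containing exactly one of the points involved; the derivative is at
     least c N^-3, so F_t becomes at least c N^-8. For t = 0 and t = 1, where
     F_t vanishes to second order, <u, w> and the 2 x 2 minors of (u, w) replace
     F_t.
   Hence points within o(N^-8) of the (partly translated) lattices of mesh 1/N,
   for a rapidly increasing sequence of N = 2 ^ a_k, avoid all the angles, if
   every requirement is met at infinitely many k. Cubes of side about N^-8
   centred at a lattice of mesh 1/N give dimension n/8; the lower bound comes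
   from coding the set by [0, 1[ through its free binary digits and comparing
   with Lebesgue measure. *)
Require Import Defs.
From HB Require Import structures.
From mathcomp Require Import all_boot all_order all_algebra.
From mathcomp Require Import all_classical all_reals all_analysis.
From mathcomp Require Import ring lra zify.
Import Order.TTheory GRing.Theory Num.Theory.
Import numFieldNormedType.Exports.
Local Open Scope classical_set_scope.
Local Open Scope ring_scope.

Set Implicit Arguments.
Unset Strict Implicit.
Unset Printing Implicit Defensive.

(** * Diophantine approximation of an irrational number *)

Lemma intr_lt1_eq0 (R : realType) (m : int) : `|m%:~R : R| < 1 -> m = 0.
Proof.
rewrite -intr_norm -[1]/(1%:~R) ltr_int => h; apply/eqP; rewrite -normr_eq0.
by have := normr_ge0 m; lia.
Qed.

(** If every scale from [L] on had a fraction p/q violating the bound, consecutive ones would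
    coincide, and one fixed fraction would approximate [t] with error tending to 0. In the
    application [16 ^+ a] is N^4 for N = 2 ^ a. *)
Lemma irrational_gap (R : realType) (t c : R) (L : nat) : 1 <= c ->
  (forall p q : int, 0 < q -> q%:~R * t <> p%:~R) ->
  exists a, (L <= a)%N /\ forall p q : int, 0 < q -> q%:~R <= c * 16 ^+ a ->
    (32 * (c * 16 ^+ a))^-1 <= `|q%:~R * t - p%:~R|.
Proof.
move=> c1 irr; apply: contrapT => nex.
have /choice[f hf] : forall j : nat, exists pq : int * int,
    [/\ 0 < pq.2, pq.2%:~R <= c * 16 ^+ (L + j) &
    `|pq.2%:~R * t - pq.1%:~R| < (32 * (c * 16 ^+ (L + j)))^-1].
  move=> j; apply: contrapT => nj; apply: nex; exists (L + j)%N.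
  split=> [|p q q0 qM]; first exact: leq_addr.
  by rewrite leNgt; apply/negP => lt; apply: nj; exists (p, q).
pose M j : R := c * 16 ^+ (L + j).
have M0 j : 1 <= M j by rewrite -[1]mulr1 ler_pM// exprn_ege1// ler1n.
have MS j : M j.+1 = 16 * M j by rewrite /M addnS exprS; ring.
(* The integer q p' - q' p equals q' (q t - p) - q (q' t - p'). As the bound [M] grows only by the
   factor 16, this is at most 1/2 + 1/512 in absolute value. *)
have step j : (f j).2 * (f j.+1).1 = (f j.+1).2 * (f j).1.
  apply/eqP; rewrite -subr_eq0; apply/eqP; apply: (@intr_lt1_eq0 R).
  have [qj Mj] := hf j; have [qj1] := hf j.+1; rewrite -/(M j) -/(M j.+1).
  rewrite -(ltr0z R) in qj; rewrite -(ltr0z R) in qj1.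
  rewrite rmorphB !rmorphM/=; move: ((f j).2%:~R) ((f j).1%:~R) ((f j.+1).2%:~R)
    ((f j.+1).1%:~R) qj qj1 Mj => q p q' p' q0 q'0 qM.
  rewrite MS -/(M j) in qM *; have := M0 j; move: (M j) qM => m qm m1 q'm h' h.
  have -> : q * p' - q' * p = q' * (q * t - p) - q * (q' * t - p') by ring.
  apply: (le_lt_trans (ler_normB _ _)).
  rewrite !normrM (gtr0_norm q0) (gtr0_norm q'0).
  have e1 : q' * `|q * t - p| <= 16 * m * (32 * m)^-1.
    by rewrite ler_pM// ltW.
  have e2 : q * `|q' * t - p'| <= m * (32 * (16 * m))^-1.
    by rewrite ler_pM// ltW.
  apply: (le_lt_trans (lerD e1 e2)).
  have m0 : m != 0 by rewrite gt_eqF// (lt_le_trans ltr01).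
  have -> : 16 * m * (32 * m)^-1 + m * (32 * (16 * m))^-1 = 2^-1 + 512^-1 :> R.
    by field.
  lra.
have all j : (f 0).2 * (f j).1 = (f j).2 * (f 0).1.
  elim: j => [|j ih]; first by [].
  have [qj _ _] := hf j; apply: (mulfI (lt0r_neq0 qj)).
  by rewrite mulrCA step mulrCA ih; ring.
have [q0 _ _] := hf 0; set d := `|(f 0).2%:~R * t - (f 0).1%:~R|.
have d0 : 0 < d by rewrite normr_gt0 subr_eq0; apply/eqP/irr.
(* All the fractions equal the first one, so q_j d = q_0 |q_j t - p_j|. Here [d] is fixed and [M j]
   unbounded, which is the contradiction. *)
have dM j : d * M j <= (f 0).2%:~R.
  have [qj _] := hf j; rewrite -/(M j) => /ltW h.
  have q1 : 1 <= (f j).2%:~R :> R by rewrite -[1]/(1%:~R) ler_int.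
  have q00 : 0 < (f 0).2%:~R :> R by rewrite ltr0z.
  have e : (f j).2%:~R * d = (f 0).2%:~R * `|(f j).2%:~R * t - (f j).1%:~R|.
    rewrite /d -[X in X * _ = _](@gtr0_norm R) ?ltr0z// -[X in _ = X * _](@gtr0_norm R) ?ltr0z//.
    rewrite -!normrM; congr `| _ |; rewrite !mulrBr -!(rmorphM (intr : int -> R)) all; ring.
  have M00 : 0 < M j by rewrite (lt_le_trans ltr01).
  rewrite -ler_pdivlMr//.
  apply: (@le_trans _ _ ((f j).2%:~R * d)); first by rewrite ler_peMl// ltW.
  rewrite e ler_pM2l//; apply: (le_trans h).
  by rewrite lef_pV2 ?posrE ?mulr_gt0//; lra.
have [k hk] : exists k : nat, (f 0).2%:~R / d < k%:R.
  exists (Num.bound ((f 0).2%:~R / d)); apply: archi_boundP.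
  by apply: divr_ge0; [rewrite ler0z ltW|exact: ltW].
have := dM k; apply/negP; rewrite -ltNge.
rewrite ltr_pdivrMr// in hk; apply: (lt_le_trans hk); rewrite mulrC ler_pM2l//.
rewrite /M -[leLHS]mul1r ler_pM//; apply: (@le_trans _ _ (16 ^+ k)); last first.
  by rewrite ler_weXn2l ?leq_addl// ler1n.
by rewrite -natrX ler_nat ltnW// ltn_expl.
Qed.

(** * The dot product: Lipschitz bounds, integrality on lattices *)

Section dot_product.
Context {R : realType} {n : nat}.
Implicit Types u v w : 'rV[R]_n.

Definition bounded_by (M : R) u := forall j, `|u ord0 j| <= M.

Definition near_by (e : R) u v := forall j, `|u ord0 j - v ord0 j| <= e.

Definition on_lattice (N : nat) u := forall j, N%:R * u ord0 j \is a Num.int.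

Lemma dotrC u v : dotr u v = dotr v u.
Proof. by apply: eq_bigr => j _; rewrite mulrC. Qed.

Lemma dotrDl u v w : dotr (u + v) w = dotr u w + dotr v w.
Proof. by rewrite -big_split; apply: eq_bigr => j _; rewrite mxE mulrDl. Qed.

Lemma dotr_delta (x : R) i w : dotr (x *: delta_mx ord0 i) w = x * w ord0 i.
Proof.
rewrite /dotr (bigD1 i)//= big1 ?addr0 => [|j ji].
  by rewrite !mxE !eqxx mulr1.
by rewrite !mxE (negbTE ji) mulr0 mul0r.
Qed.

Lemma dotr_ge0 u : 0 <= dotr u u.
Proof. by apply: sumr_ge0 => j _; rewrite -expr2 sqr_ge0. Qed.

Lemma dotr_eq0 u : (dotr u u == 0) = (u == 0).
Proof.
apply/eqP/eqP => [|->]; last by apply: big1 => j _; rewrite mxE mul0r.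
move=> /eqP; rewrite psumr_eq0 => [/allP u0|j _]; last by rewrite -expr2 sqr_ge0.
apply/rowP => j; rewrite mxE; apply/eqP.
by have := u0 j (mem_index_enum _); rewrite mulf_eq0 orbb.
Qed.

Lemma dist_mul_le (A B x y a b a' b' : R) : `|a| <= A -> `|b'| <= B ->
  `|a - a'| <= x -> `|b - b'| <= y -> `|a * b - a' * b'| <= A * y + x * B.
Proof.
move=> aA bB ax by_; have -> : a * b - a' * b' = a * (b - b') + (a - a') * b'.
  by ring.
by apply: (le_trans (ler_normD _ _)); rewrite !normrM lerD// ler_pM.
Qed.

Lemma dotr_bound (M M' : R) u v : bounded_by M u -> bounded_by M' v ->
  `|dotr u v| <= n%:R * (M * M').
Proof.
move=> uM vM; apply: (le_trans (ler_norm_sum _ _ _)).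
rewrite mulr_natl -[n in _ *+ n]card_ord -sumr_const; apply: ler_sum => j _.
by rewrite normrM ler_pM.
Qed.

Lemma dotr_lipschitz (M e : R) u u' v v' : bounded_by M u -> bounded_by M v' ->
  near_by e u u' -> near_by e v v' ->
  `|dotr u v - dotr u' v'| <= n%:R * (2 * M * e).
Proof.
move=> uM vM uu vv; rewrite /dotr -sumrB.
apply: (le_trans (ler_norm_sum _ _ _)).
rewrite mulr_natl -[n in _ *+ n]card_ord -sumr_const; apply: ler_sum => j _.
have -> : 2 * M * e = M * e + e * M by ring.
exact: dist_mul_le.
Qed.

Lemma lattice_dotr N u v : on_lattice N u -> on_lattice N v ->
  N%:R ^+ 2 * dotr u v \is a Num.int.
Proof.
move=> uN vN; rewrite /dotr mulr_sumr rpred_sum// => j _.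
rewrite (_ : _ * _ = N%:R * u ord0 j * (N%:R * v ord0 j)); last by ring.
by rewrite rpredM.
Qed.

Lemma on_latticeB N u v : on_lattice N u -> on_lattice N v ->
  on_lattice N (u - v).
Proof. by move=> uN vN j; rewrite !mxE mulrBr rpredB. Qed.

(* [D] plays the role of the partial derivative of [f] in the [i]-th coordinate
   of the first argument; 2 exceeds the diameter of the set to be built. *)
Record shift_form (i : 'I_n) (f D : 'rV[R]_n -> 'rV[R]_n -> R) (C b : R) :
    Prop := ShiftForm {
  sf_C : 0 <= C ;
  sf_b : 0 < b ;
  sf_lip : forall e u u' w w',
    bounded_by 2 u -> bounded_by 2 u' -> bounded_by 2 w -> bounded_by 2 w' ->
    near_by e u u' -> near_by e w w' -> `|f u w - f u' w'| <= C * e ;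
  sf_lipD : forall e u u' w w',
    bounded_by 2 u -> bounded_by 2 u' -> bounded_by 2 w -> bounded_by 2 w' ->
    near_by e u u' -> near_by e w w' -> `|D u w - D u' w'| <= C * e ;
  sf_boundD : forall u w, bounded_by 2 u -> bounded_by 2 w -> `|D u w| <= C ;
  sf_expand : forall x u w, bounded_by 2 u -> bounded_by 2 w ->
    `|f (u + x *: delta_mx ord0 i) w - f u w - x * D u w| <= C * x ^+ 2 ;
  sf_int : forall N u w, on_lattice N u -> on_lattice N w ->
    b * N%:R ^+ 4 * f u w \is a Num.int ;
  sf_intD : forall N u w, on_lattice N u -> on_lattice N w ->
    b * N%:R ^+ 3 * D u w \is a Num.int }.

(** The polynomial F_t: for nonzero vectors it vanishes exactly when their squared cosine is [t].
    Squaring removes the roots in [enorm], at the price of excluding an angle together with its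
    supplement. *)
Definition angle_form (t : R) u w :=
  dotr u w ^+ 2 - t * (dotr u u * dotr w w).

(** On vectors with coordinates at most 2, [dotr] is bounded by 4n and moves by at most 4n e, so
    each of the two products contributes 2 * 4n * 4n e. *)
Lemma angle_form_lipschitz (t e : R) u u' w w' : 0 <= t <= 1 ->
  bounded_by 2 u -> bounded_by 2 u' -> bounded_by 2 w -> bounded_by 2 w' ->
  near_by e u u' -> near_by e w w' ->
  `|angle_form t u w - angle_form t u' w'| <= 64 * n%:R ^+ 2 * e.
Proof.
move=> /andP[t0 t1] bu bu' bw bw' uu ww.
have e0 : 0 <= n%:R * e.
  by have := dotr_lipschitz bu bu' uu uu; have := normr_ge0 (dotr u u - dotr u' u'); lra.
rewrite /angle_form.
have -> : dotr u w ^+ 2 - t * (dotr u u * dotr w w) -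
   (dotr u' w' ^+ 2 - t * (dotr u' u' * dotr w' w')) =
   (dotr u w * dotr u w - dotr u' w' * dotr u' w') -
   t * (dotr u u * dotr w w - dotr u' u' * dotr w' w') by ring.
have Hb a b : bounded_by 2 a -> bounded_by 2 b -> `|dotr a b| <= 4 * n%:R.
  by move=> /dotr_bound h /h{h}; lra.
have h1 := dist_mul_le (Hb _ _ bu bw) (Hb _ _ bu' bw')
  (dotr_lipschitz bu bw' uu ww) (dotr_lipschitz bu bw' uu ww).
have h2 := dist_mul_le (Hb _ _ bu bu) (Hb _ _ bw' bw')
  (dotr_lipschitz bu bu' uu uu) (dotr_lipschitz bw bw' ww ww).
apply: (le_trans (ler_normB _ _)); rewrite normrM (ger0_norm t0).
have h3 : t * `|dotr u u * dotr w w - dotr u' u' * dotr w' w'| <=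
    `|dotr u u * dotr w w - dotr u' u' * dotr w' w'| by rewrite ler_piMl.
apply: (le_trans (lerD h1 (le_trans h3 h2))).
by rewrite le_eqVlt; apply/orP; left; apply/eqP; ring.
Qed.

End dot_product.

(** * Forms whose zeros are destroyed by a translation *)

Section shift_forms.
Context {R : realType} {n : nat}.
Implicit Types u v w : 'rV[R]_n.

Lemma bounded_byW (M M' : R) u : M <= M' -> bounded_by M u -> bounded_by M' u.
Proof. by move=> MM' uM j; exact: le_trans (uM j) MM'. Qed.

Lemma near_by_ge0 (e : R) (i : 'I_n) u v : near_by e u v -> 0 <= e.
Proof. by move=> /(_ i); exact: le_trans. Qed.

(** This lemma and the next bring the constants of the three forms below under the common value 64
    n^2; the index [i] makes [n] positive. *)
Lemma form_const_ge (i : 'I_n) (c : R) : 0 <= c <= 64 -> c <= 64 * n%:R ^+ 2.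
Proof.
move=> /andP[c0 c64]; apply: (le_trans c64); rewrite ler_peMr// exprn_ege1//.
by rewrite ler1n; case: n i => // -[].
Qed.

Lemma form_constn_ge (c : R) : 0 <= c <= 64 -> c * n%:R <= 64 * n%:R ^+ 2.
Proof.
move=> /andP[c0 c64]; apply: ler_pM => //; rewrite -natrX ler_nat.
by case: n => // m; rewrite expnS leq_pmulr// expn_gt0.
Qed.

(** Serves t = 0. The form is linear in its first argument, so the expansion is exact. *)
Lemma dotr_shift_form i : shift_form i (@dotr R n) (fun _ w => w ord0 i)
  (64 * n%:R ^+ 2 : R) 1.
Proof.
split.
- by rewrite mulr_ge0// sqr_ge0.
- exact: ltr01.
- move=> e u u' w w' bu bu' bw bw' uu ww.
  apply: (le_trans (dotr_lipschitz bu bw' uu ww)).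
  rewrite mulrA ler_wpM2r ?(near_by_ge0 i uu)// [leLHS]mulrC form_constn_ge//.
  lra.
- move=> e u u' w w' bu bu' bw bw' uu ww; apply: (le_trans (ww i)).
  by rewrite ler_peMl ?(near_by_ge0 i uu)// (form_const_ge i)//; lra.
- by move=> u w bu bw; apply: (le_trans (bw i)); rewrite (form_const_ge i)//; lra.
- move=> x u w bu bw; rewrite dotrDl dotr_delta (_ : _ - _ = 0); last by ring.
  rewrite normr0.
  by rewrite mulr_ge0 ?sqr_ge0// mulr_ge0 ?sqr_ge0.
- move=> N u w Nu Nw; rewrite mul1r (exprD _ 2 2) -mulrA rpredM//.
    by rewrite rpredX// natr_int.
  exact: lattice_dotr.
- move=> N u w Nu Nw; rewrite mul1r exprSr -mulrA rpredM//.
  by rewrite rpredX// natr_int.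
Qed.

(** Serves t = 1: all minors of collinear vectors vanish, but only to first order when [w ord0 j] is
    nonzero. *)
Lemma minor_shift_form i j : i != j -> shift_form i
  (fun u w => u ord0 i * w ord0 j - u ord0 j * w ord0 i)
  (fun _ w => w ord0 j) (64 * n%:R ^+ 2 : R) 1.
Proof.
move=> ij; split.
- by rewrite mulr_ge0// sqr_ge0.
- exact: ltr01.
- move=> e u u' w w' bu bu' bw bw' uu ww.
  have -> : u ord0 i * w ord0 j - u ord0 j * w ord0 i -
    (u' ord0 i * w' ord0 j - u' ord0 j * w' ord0 i) =
    (u ord0 i * w ord0 j - u' ord0 i * w' ord0 j) -
    (u ord0 j * w ord0 i - u' ord0 j * w' ord0 i) by ring.
  apply: (le_trans (ler_normB _ _)).
  have h1 := dist_mul_le (bu i) (bw' j) (uu i) (ww j).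
  have h2 := dist_mul_le (bu j) (bw' i) (uu j) (ww i).
  apply: (@le_trans _ _ (8 * e)); first by lra.
  by rewrite ler_wpM2r ?(near_by_ge0 i uu)// (form_const_ge i)//; lra.
- move=> e u u' w w' bu bu' bw bw' uu ww; apply: (le_trans (ww j)).
  by rewrite ler_peMl ?(near_by_ge0 i uu)// (form_const_ge i)//; lra.
- by move=> u w bu bw; apply: (le_trans (bw j)); rewrite (form_const_ge i)//; lra.
- move=> x u w bu bw; rewrite !mxE !eqxx (eq_sym j) (negbTE ij) /=.
  rewrite (_ : _ - _ = 0); last by rewrite mulr1 mulr0; ring.
  by rewrite normr0 mulr_ge0 ?sqr_ge0// mulr_ge0 ?sqr_ge0.
- move=> N u w Nu Nw; rewrite mul1r.
  rewrite (_ : _ * _ = N%:R ^+ 2 * (N%:R * u ord0 i * (N%:R * w ord0 j) -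
    N%:R * u ord0 j * (N%:R * w ord0 i))); last by ring.
  by rewrite rpredM ?rpredB ?rpredX ?natr_int// rpredM.
- move=> N u w Nu Nw; rewrite mul1r exprSr -mulrA rpredM//.
  by rewrite rpredX// natr_int.
Qed.

(** [q] clears the denominator of [t]. The form is quadratic in its first argument, so the expansion
    error is exactly (w_i^2 - t |w|^2) x^2. *)
Lemma angle_shift_form i (t : R) (p q : int) : 0 <= t <= 1 -> 0 < q ->
  q%:~R * t = p%:~R ->
  shift_form i (angle_form t)
  (fun u w => 2 * (dotr u w * w ord0 i - t * (dotr w w * u ord0 i)))
  (64 * n%:R ^+ 2) q%:~R.
Proof.
move=> t01 q0 qt; have /andP[t0 t1] := t01.
have Hb (a b : 'rV[R]_n) : bounded_by 2 a -> bounded_by 2 b -> `|dotr a b| <= 4 * n%:R.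
  by move=> /dotr_bound h /h{h}; lra.
have nN (z : R) : t * `|z| <= `|z| by rewrite ler_piMl.
split.
- by rewrite mulr_ge0// sqr_ge0.
- by rewrite ltr0z.
- by move=> *; exact: angle_form_lipschitz.
- move=> e u u' w w' bu bu' bw bw' uu ww; rewrite -mulrBr.
  have -> : dotr u w * w ord0 i - t * (dotr w w * u ord0 i) -
    (dotr u' w' * w' ord0 i - t * (dotr w' w' * u' ord0 i)) =
    (dotr u w * w ord0 i - dotr u' w' * w' ord0 i) -
    t * (dotr w w * u ord0 i - dotr w' w' * u' ord0 i) by ring.
  have h1 := dist_mul_le (Hb _ _ bu bw) (bw' i) (dotr_lipschitz bu bw' uu ww) (ww i).
  have h2 := dist_mul_le (Hb _ _ bw bw) (bu' i) (dotr_lipschitz bw bw' ww ww) (uu i).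
  rewrite normrM ger0_norm//.
  have := ler_normB (dotr u w * w ord0 i - dotr u' w' * w' ord0 i)
    (t * (dotr w w * u ord0 i - dotr w' w' * u' ord0 i)).
  rewrite (normrM t) (ger0_norm t0) => h3.
  have h4 := nN (dotr w w * u ord0 i - dotr w' w' * u' ord0 i).
  apply: (@le_trans _ _ (48 * n%:R * e)); first by lra.
  by rewrite ler_wpM2r ?(near_by_ge0 i uu)// form_constn_ge//; lra.
- move=> u w bu bw; rewrite normrM ger0_norm//.
  have := ler_normB (dotr u w * w ord0 i) (t * (dotr w w * u ord0 i)).
  rewrite (normrM t) (ger0_norm t0) => h3.
  have h4 := nN (dotr w w * u ord0 i).
  have h1 : `|dotr u w * w ord0 i| <= 4 * n%:R * 2 by rewrite normrM ler_pM// Hb.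
  have h2 : `|dotr w w * u ord0 i| <= 4 * n%:R * 2 by rewrite normrM ler_pM// Hb.
  apply: (@le_trans _ _ (32 * n%:R)); first by lra.
  by rewrite form_constn_ge//; lra.
- move=> x u w bu bw; rewrite /angle_form.
  rewrite !dotrDl !dotr_delta (dotrC u (u + _)) dotrDl dotr_delta.
  rewrite !mxE !eqxx mulr1.
  rewrite (_ : _ - _ = (w ord0 i ^+ 2 - t * dotr w w) * x ^+ 2); last by ring.
  rewrite normrM (@ger0_norm _ (x ^+ 2)) ?sqr_ge0// ler_wpM2r ?sqr_ge0//.
  apply: (le_trans (ler_normB _ _)); rewrite (normrM t) (ger0_norm t0).
  have h1 : `|w ord0 i ^+ 2| <= 2 * 2 by rewrite normrX expr2 ler_pM.
  have h2 := nN (dotr w w); have h3 := Hb _ _ bw bw.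
  apply: (@le_trans _ _ (8 * n%:R)); last by rewrite form_constn_ge//; lra.
  have : 1 <= n%:R :> R by rewrite ler1n; case: n i {u w bu bw Hb h1 h2 h3} => // -[].
  by move: (n%:R) h3 => m h3 h5; lra.
- move=> N u w Nu Nw; rewrite /angle_form.
  rewrite (_ : _ * _ = q%:~R * (N%:R ^+ 2 * dotr u w) ^+ 2 -
    (q%:~R * t) * (N%:R ^+ 2 * dotr u u * (N%:R ^+ 2 * dotr w w))); last by ring.
  rewrite qt; apply: rpredB; rewrite rpredM ?intr_int//.
    by rewrite rpredX// lattice_dotr.
  by rewrite rpredM// lattice_dotr.
- move=> N u w Nu Nw.
  rewrite (_ : _ * _ = 2 * (q%:~R * (N%:R ^+ 2 * dotr u w * (N%:R * w ord0 i)) -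
    (q%:~R * t) * (N%:R ^+ 2 * dotr w w * (N%:R * u ord0 i)))); last by ring.
  rewrite qt; apply: rpredM; first exact: natr_int.
  by apply: rpredB; rewrite rpredM ?intr_int// rpredM// lattice_dotr.
Qed.

(** Put Z = f U W, G = D U W, e = N^-5, rho = N^-8 2^-k. Closeness and f u w = 0 force Z + e G =
    O(rho + e^2). If Z = 0, integrality gives |e G| >= N^-8 / b; otherwise |Z| >= N^-4 / b, while e
    G = O(N^-5). Both fail for large k. *)
Lemma shift_form_avoid i f D C b u w : shift_form i f D C b ->
  bounded_by 1 u -> bounded_by 1 w -> f u w = 0 -> D u w != 0 ->
  exists K, forall k N U W, (K <= k)%N -> (2 ^ k <= N)%N ->
    bounded_by 1 U -> bounded_by 1 W -> on_lattice N U -> on_lattice N W ->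
    near_by ((N%:R ^+ 8 * 2 ^+ k)^-1) u (U + (N%:R ^- 5) *: delta_mx ord0 i) ->
    near_by ((N%:R ^+ 8 * 2 ^+ k)^-1) w W -> False.
Proof.
move=> sf bu bw f0 D0; set d := `|D u w|; have d0 : 0 < d by rewrite normr_gt0.
have C0 := sf_C sf; have b0 := sf_b sf.
have bC : 0 <= b * C by rewrite mulr_ge0// ltW.
have Cd : 0 <= 2 * C / d by rewrite divr_ge0 ?mulr_ge0// ltW.
(* The first term keeps [D U W] nonzero; the second defeats the integrality bounds, where at most
   three errors of size b C / 2^k add up. *)
have [K hK] : exists K : nat, 2 * C / d + 3 * (b * C) < K%:R.
  exists (Num.bound (2 * C / d + 3 * (b * C))); apply: archi_boundP.
  by rewrite addr_ge0// mulr_ge0.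
exists K => k N U W Kk kN bU bW NU NW uU wW.
set y : R := 2 ^+ k in uU wW; set x : R := N%:R in uU wW.
have yK : 2 * C / d + 3 * (b * C) < y.
  apply: (lt_trans hK); rewrite /y -natrX ltr_nat.
  by apply: (leq_ltn_trans Kk); exact: ltn_expl.
have y1 : 1 <= y by rewrite exprn_ege1// ler1n.
have yx : y <= x by rewrite /x /y -natrX ler_nat.
have x1 : 1 <= x := le_trans y1 yx.
have xn m : 1 <= x ^+ m by rewrite exprn_ege1.
have xn0 m : 0 < x ^+ m := lt_le_trans ltr01 (xn m).
have x0 := xn0 1; rewrite expr1 in x0; have y0 := lt_le_trans ltr01 y1.
have y'1 : y^-1 <= 1 by rewrite invf_le1.
have x'y : x^-1 <= y^-1 by rewrite lef_pV2// posrE.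
have x'0 : 0 < x^-1 by rewrite invr_gt0.
have x'1 : x^-1 <= 1 := le_trans x'y y'1.
have xV m : x ^- m.+1 <= x^-1.
  by rewrite lef_pV2 ?posrE// exprS ler_peMr// ltW.
set rho := (x ^+ 8 * y)^-1 in uU wW; set e := x ^- 5 in uU.
have rho0 : 0 <= rho by rewrite invr_ge0 mulr_ge0// ltW.
have rhoy : rho <= y^-1 by rewrite lef_pV2 ?posrE ?mulr_gt0// ler_peMl// ltW.
have e0 : 0 <= e by rewrite invr_ge0 ltW.
have ex : e <= x^-1 := xV 4.
have b2 v : bounded_by 1 v -> bounded_by 2 v by apply: bounded_byW; lra.
have bU' : bounded_by 2 (U + e *: delta_mx ord0 i).
  move=> j; rewrite !mxE; apply: (le_trans (ler_normD _ _)).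
  have := bU j; have : `|e * (true && (j == i))%:R| <= 1.
    by rewrite normrM ger0_norm//; case: (j == i); rewrite ?normr1 ?normr0; lra.
  by rewrite eqxx; lra.
(* Translation and error are each at most 1 / y, which is enough to compare derivatives. *)
have nD : near_by (2 / y) u U.
  move=> j; have := uU j; rewrite !mxE opprD addrA => h.
  have : `|e * (true && (j == i))%:R| <= e.
    by rewrite normrM ger0_norm//; case: (j == i); rewrite ?normr1 ?normr0; lra.
  rewrite eqxx in h *; move: (e * _) h => z h hz.
  have := ler_normD (u ord0 j - U ord0 j - z) z; rewrite subrK; lra.
have nW : near_by (2 / y) w W.
  have y'0 : 0 < y^-1 by rewrite invr_gt0.
  by move=> j; apply: (le_trans (wW j)); lra.
have hD := sf_lipD sf (b2 _ bu) (b2 _ bU) (b2 _ bw) (b2 _ bW) nD nW.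
have G0 : D U W != 0.
  apply/eqP => G0; move: hD; rewrite G0 subr0 -/d leNgt => /negP; apply.
  rewrite mulrCA mulrA ltr_pdivrMr// [ltRHS]mulrC -ltr_pdivrMr//.
  by rewrite -[ltLHS]addr0 (le_lt_trans _ yK)// lerD2l mulr_ge0.
have hf := sf_lip sf (b2 _ bu) bU' (b2 _ bw) (b2 _ bW) uU wW.
rewrite f0 sub0r normrN in hf.
have hE := sf_expand sf e (b2 _ bU) (b2 _ bW).
have hG := sf_boundD sf (b2 _ bU) (b2 _ bW).
have iZ := sf_int sf NU NW; have iG := sf_intD sf NU NW.
rewrite -/x in iZ iG.
move: (f (U + _) W) (f U W) (D U W) hf hE hG iZ iG G0 => z Z G hz hE hG iZ iG G0.
have hZ : `|Z + e * G| <= C * rho + C * e ^+ 2.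
  have -> : Z + e * G = z - (z - Z - e * G) by ring.
  by apply: (le_trans (ler_normB _ _)); rewrite lerD.
have [Z0|Z0] := eqVneq Z 0.
  have : 1 <= `|b * x ^+ 3 * G|.
    apply: norm_intr_ge1 => //; rewrite !mulf_neq0// ?gt_eqF//.
  rewrite Z0 add0r in hZ.
  have -> : b * x ^+ 3 * G = (b * x ^+ 8) * (e * G).
    by rewrite /e; field; rewrite gt_eqF.
  rewrite (normrM (b * _)) gtr0_norm ?mulr_gt0// => h.
  have : 1 <= b * x ^+ 8 * (C * rho + C * e ^+ 2).
    by apply: (le_trans h); rewrite ler_pM2l ?mulr_gt0.
  have -> : b * x ^+ 8 * (C * rho + C * e ^+ 2) = b * C * y^-1 + b * C * x ^- 2.
    by rewrite /rho /e; field; rewrite !gt_eqF.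
  move=> h1; have : 1 <= b * C * y^-1 + b * C * y^-1.
    apply: (le_trans h1); rewrite lerD2l ler_wpM2l//.
    exact: le_trans (xV 1%N) x'y.
  by rewrite -mulrDl ler_pdivlMr// mul1r; lra.
have : 1 <= `|b * x ^+ 4 * Z|.
  by apply: norm_intr_ge1 => //; rewrite !mulf_neq0// gt_eqF.
rewrite (normrM (b * _)) gtr0_norm ?mulr_gt0// => h.
have hZ' : `|Z| <= C * rho + C * e ^+ 2 + C * e.
  rewrite -[Z](addrK (e * G)); apply: (le_trans (ler_normB _ _)).
  by rewrite lerD// normrM ger0_norm// mulrC ler_wpM2r.
have : 1 <= b * x ^+ 4 * (C * rho + C * e ^+ 2 + C * e).
  by apply: (le_trans h); rewrite ler_pM2l ?mulr_gt0.
have -> : b * x ^+ 4 * (C * rho + C * e ^+ 2 + C * e) =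
  b * C * (x ^- 4 * y^-1 + x ^- 6 + x^-1).
  by rewrite /rho /e; field; rewrite !gt_eqF.
move=> h1; have : 1 <= b * C * (3 * y^-1).
  apply: (le_trans h1); rewrite ler_wpM2l//.
  have h4 : x ^- 4 * y^-1 <= y^-1.
    rewrite ler_piMl ?invr_ge0 ?(ltW y0)//; exact: le_trans (xV 3%N) x'1.
  by have := xV 5%N; lra.
by rewrite mulrA ler_pdivlMr// mul1r; lra.
Qed.

End shift_forms.

(** * Elementary estimates for Hausdorff measures *)

Section hausdorff_tools.
Context {R : realType} {n : nat}.
Implicit Types (A V : set 'rV[R]_n) (s c : R).

Lemma expr_eventually_lt (r e : R) : 0 <= r < 1 -> 0 < e ->
  exists K, forall k, (K <= k)%N -> r ^+ k < e.
Proof.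
move=> /andP[r0 r1] e0.
have r1' : `|r| < 1 by rewrite ger0_norm.
have /cvgr0Pnorm_lt/(_ _ e0)[K _ hK] := cvg_expr r1'.
exists K => k Kk; have := hK k Kk; rewrite /= ger0_norm// exprn_ge0//.
Qed.

Lemma enorm_ge_coord (u : 'rV[R]_n) j : `|u ord0 j| <= enorm u.
Proof.
rewrite /enorm -sqrtr_sqr ler_wsqrtr// /dotr (bigD1 j)//= -expr2.
by rewrite lerDl sumr_ge0// => i _; rewrite -expr2 sqr_ge0.
Qed.

Lemma enorm_le (u : 'rV[R]_n) c : 0 <= c -> bounded_by c u ->
  enorm u <= n%:R * c.
Proof.
move=> c0 uc; have nc : 0 <= n%:R * c by rewrite mulr_ge0.
rewrite -[leRHS]ger0_norm// -sqrtr_sqr ler_wsqrtr//.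
apply: le_trans (ler_norm _) _; apply: le_trans (dotr_bound uc uc) _.
rewrite exprMn -expr2 ler_wpM2r ?sqr_ge0// -natrX ler_nat.
by case: n => // m; rewrite leq_pmulr.
Qed.

Lemma ediam_le V c : 0 <= c ->
  (forall x y, V x -> V y -> enorm (x - y) <= c) -> (ediam V <= c%:E)%E.
Proof.
move=> c0 Vc; rewrite /ediam ge_max lee_fin c0 /=; apply: ge_ereal_sup.
by move=> _ [x Vx [y Vy <-]]; rewrite lee_fin Vc.
Qed.

Lemma ediam_ge0 V : (0 <= ediam V)%E.
Proof. by rewrite /ediam le_max lexx. Qed.

Lemma ediam_ge V x y : V x -> V y -> ((enorm (x - y))%:E <= ediam V)%E.
Proof.
move=> Vx Vy; rewrite /ediam le_max; apply/orP; right.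
by apply: ereal_sup_ubound; exists x => //; exists y.
Qed.

Lemma hausdorff_weight_ge0 s A : (0 <= hausdorff_weight s A)%E.
Proof. by rewrite /hausdorff_weight; case: ifP => // _; exact: poweR_ge0. Qed.

Lemma hausdorff_weight_le s c A : 0 <= s -> 0 <= c -> (ediam A <= c%:E)%E ->
  (hausdorff_weight s A <= (c `^ s)%:E)%E.
Proof.
move=> s0 c0 Ac; rewrite /hausdorff_weight; case: ifP => _.
  by rewrite lee_fin powR_ge0.
rewrite -poweR_EFin; apply: gt0_ler_poweR => //.
  by rewrite in_itv/= ediam_ge0 leey.
by rewrite in_itv/= lee_fin c0 leey.
Qed.

Lemma hausdorff_premeasure_ge0 s c A : (0 <= hausdorff_premeasure s c A)%E.
Proof.
apply: le_ereal_inf_tmp => _ [U _ <-]; apply: nneseries_ge0 => k _ _.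
exact: hausdorff_weight_ge0.
Qed.

Lemma hausdorff_premeasure_fin_cover (T : finType) (F : T -> set 'rV[R]_n)
    s c d A : 0 <= s -> 0 <= c <= d -> A `<=` \bigcup_t F t ->
  (forall t, ediam (F t) <= c%:E)%E ->
  (hausdorff_premeasure s d A <= (#|T|%:R * c `^ s)%:E)%E.
Proof.
move=> s0 /andP[c0 cd] AF Fc.
(* Padding by the empty set, of weight 0 even for [s = 0], makes the finite family a sequence at no
   cost. *)
pose U (k : nat) := nth set0 [seq F t | t <- enum T] k.
have szU : size [seq F t | t <- enum T] = #|T| by rewrite size_map cardE.
have U0 k : (#|T| <= k)%N -> U k = set0 by move=> Tk; rewrite /U nth_default// szU.
have Uc k : (ediam (U k) <= c%:E)%E.
  have [Tk|kT] := leqP #|T| k; first by rewrite U0// ediam_le.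
  have : U k \in [seq F t | t <- enum T] by rewrite mem_nth// szU.
  by move=> /mapP[t _ ->].
apply: ge_ereal_inf; exists (\sum_(k <oo) hausdorff_weight s (U k))%E.
  exists U => //; split=> [x /AF[t _ Ftx]|k]; last first.
    by apply: (le_trans (Uc k)); rewrite lee_fin.
  exists (index t (enum T)) => //; rewrite /U (nth_map t) ?nth_index ?mem_enum//.
  by rewrite index_mem mem_enum.
rewrite (@nneseries_split _ _ 0 #|T|); last first.
  by move=> k _; exact: hausdorff_weight_ge0.
rewrite add0n eseries0 ?adde0; last first.
  by move=> k Tk _; rewrite U0// /hausdorff_weight eqxx.
apply: (@le_trans _ _ (\sum_(0 <= k < #|T|) (c `^ s)%:E)%E).
  by apply: lee_sum => k _; exact: hausdorff_weight_le.
by rewrite sumEFin sumr_const_nat subn0 mulr_natl.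
Qed.

End hausdorff_tools.

(** * The Cantor set: compactness and the upper bound for its dimension *)

Section cantor_set.
Context {R : realType} {n : nat}.
Variables (a : nat -> nat) (chi : nat -> 'rV[R]_n -> bool) (dir : nat -> 'I_n).

(** With N = 2 ^ a k the boxes have side N^-8 2^-k: the summand [k] makes the side o(N^-8), and is
    negligible against [a k] once [a] grows fast. *)
Definition box_exponent k := (8 * a k + k)%N.

Definition grid_point k (m : 'I_n -> nat) : 'rV[R]_n :=
  \row_j ((m j)%:R / 2 ^+ a k).

Definition shift_size k (X : 'rV[R]_n) : R :=
  if chi k X then 2 ^- (5 * a k) else 0.

Definition corner k (X : 'rV[R]_n) : 'rV[R]_n :=
  X + shift_size k X *: delta_mx ord0 (dir k).

Definition box k (X : 'rV[R]_n) : set 'rV[R]_n :=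
  [set x | forall j, corner k X ord0 j <= x ord0 j <=
                     corner k X ord0 j + 2 ^- box_exponent k].

(** Each stage ranges over the whole grid, so the stages are not nested by definition; nested boxes
    are selected by the coding below. *)
Definition cantor_set : set 'rV[R]_n :=
  \bigcap_k \bigcup_(m : {ffun 'I_n -> 'I_(2 ^ a k)}) box k (grid_point k (fun j => m j)).

Lemma shift_size_ge0 k X : 0 <= shift_size k X.
Proof. by rewrite /shift_size; case: ifP => // _; rewrite invr_ge0 exprn_ge0. Qed.

Lemma shift_size_le k X : shift_size k X <= 2 ^- (5 * a k).
Proof. by rewrite /shift_size; case: ifP => // _; rewrite invr_ge0 exprn_ge0. Qed.

Lemma cornerE k X j : corner k X ord0 j =
  X ord0 j + (if j == dir k then shift_size k X else 0).
Proof. by rewrite !mxE eqxx /=; case: ifP => _; rewrite ?mulr1 ?mulr0. Qed.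

Lemma closed_box k X : closed (box k X).
Proof.
rewrite (_ : box k X = \bigcap_j ((fun x : 'rV[R]_n => x ord0 j) @^-1`
  [set y | corner k X ord0 j <= y] `&` (fun x : 'rV[R]_n => x ord0 j) @^-1`
  [set y | y <= corner k X ord0 j + 2 ^- box_exponent k])).
  apply: closed_bigI => j _; apply: closedI; apply: preimage_closed.
  - by move=> x _; exact: coord_continuous.
  - exact: closed_ge.
  - by move=> x _; exact: coord_continuous.
  - exact: closed_le.
apply/seteqP; split=> x /= h j.
  by move=> _; have /andP[h1 h2] := h j; split.
by have [h1 h2] := h j I; rewrite h1.
Qed.

Lemma pow2V_le1 m : 0 < (2 ^- m : R) <= 1.
Proof. by rewrite invr_gt0 exprn_gt0//= invf_le1 ?exprn_ege1 ?exprn_gt0// ler1n. Qed.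

Lemma grid_point_itv k (m : {ffun 'I_n -> 'I_(2 ^ a k)}) j :
  0 <= grid_point k (fun j => m j) ord0 j <= 1.
Proof.
rewrite mxE divr_ge0 ?exprn_ge0//= ler_pdivrMr ?exprn_gt0// mul1r -natrX.
by rewrite ler_nat ltnW.
Qed.

Lemma compact_cantor_set : compact cantor_set.
Proof.
apply: (@subclosed_compact _ _ [set v : 'rV[R]_n |
  forall j, (`[0, 3]%classic : set R) (v ord0 j)]).
- apply: closed_bigI => k _; apply: (@closed_bigcup _ {ffun 'I_n -> 'I_(2 ^ a k)} setT).
    exact: finite_finset.
  by move=> m _; exact: closed_box.
- apply: (@rV_compact _ _ (fun=> `[(0 : R), 3]%classic)) => j.
  exact: segment_compact.
- move=> x Ex j; have [m _ /(_ j)] := Ex 0 I; rewrite /= in_itv/= cornerE.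
  have /andP[_ h1] := grid_point_itv m j; have /andP[h0 _] := grid_point_itv m j.
  have h2 := shift_size_ge0 0 (grid_point 0 (fun j => m j)).
  have h3 := shift_size_le 0 (grid_point 0 (fun j => m j)).
  have /andP[_ h4] := pow2V_le1 (5 * a 0); have /andP[_ h5] := pow2V_le1 (box_exponent 0).
  move: (grid_point _ _ _ _) (shift_size _ _) h0 h1 h2 h3 => g e g0 g1 e0 e1.
  by case: ifP => _; lra.
Qed.

Lemma ediam_box k X : (ediam (box k X) <= (n%:R * 2 ^- box_exponent k)%:E)%E.
Proof.
have /andP[e0 _] := pow2V_le1 (box_exponent k).
apply: ediam_le => [|x y bx By]; first by rewrite mulr_ge0// ltW.
apply: enorm_le; first exact: ltW.
by move=> j; have := bx j; have := By j; rewrite !mxE ler_norml; lra.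
Qed.

Hypothesis a_ge : forall k, (k <= a k)%N.

(** At stage k there are 2^(n a_k) boxes of diameter at most n 2^-(8 a_k + k). Their total weight is
    at most n^s r^(a_k) with r = 2^(n - 8 s) < 1. *)
Lemma hausdorff_measure_cantor_eq0 s : n%:R / 8 < s ->
  hausdorff_measure s cantor_set = 0.
Proof.
move=> ns; have s0 : 0 <= s by apply: le_trans (ltW ns); rewrite divr_ge0.
apply/eqP; rewrite eq_le; apply/andP; split; last first.
  apply: le_ereal_sup_tmp; exists (hausdorff_premeasure s 1 cantor_set).
    by exists 1 => //=.
  exact: hausdorff_premeasure_ge0.
apply: ge_ereal_sup => _ [d /= d0 <-]; apply/lee_addgt0Pr => e e0; rewrite add0e.
pose r : R := 2 `^ (n%:R - 8 * s).
have r01 : 0 <= r < 1.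
  have ns8 : n%:R - 8 * s < 0 by rewrite subr_lt0 mulrC -ltr_pdivrMr.
  have r1 : r <= 1 by rewrite -(powRr0 2) ler_powR ?ler1n// ltW.
  rewrite powR_ge0 lt_neqAle r1 powR_eq1 (lt_eqF ns8) orbF negb_or -leNgt ler0n.
  by rewrite !andbT pnatr_eq1.
have ns0 : 0 <= n%:R `^ s :> R by exact: powR_ge0.
have [K1 hK1] := expr_eventually_lt r01 (divr_gt0 e0 (ltr_wpDl ns0 ltr01)).
have h01 : 0 <= (2^-1 : R) < 1 by lra.
have [K2 hK2] := expr_eventually_lt h01 (divr_gt0 d0 (ltr_wpDl (ler0n R n) ltr01)).
pose k := maxn K1 K2.
have h1 : n%:R `^ s * r ^+ a k <= e.
  have : r ^+ a k < e / (n%:R `^ s + 1).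
    by apply: hK1; apply: leq_trans (a_ge k); exact: leq_maxl.
  rewrite ltr_pdivlMr ?ltr_wpDl// => /ltW; apply: le_trans.
  have := exprn_ge0 (a k) (andP r01).1; nra.
have /andP[p0 _] := pow2V_le1 (box_exponent k).
have h2 : n%:R * 2 ^- box_exponent k <= d.
  have : (2^-1) ^+ box_exponent k < d / (n%:R + 1).
    apply: hK2; apply: (@leq_trans k); first exact: leq_maxr.
    exact: leq_addl.
  rewrite exprVn ltr_pdivlMr ?ltr_wpDl// => /ltW; apply: le_trans.
  by nra.
apply: (@le_trans _ _ (#|{ffun 'I_n -> 'I_(2 ^ a k)}|%:R *
    (n%:R * 2 ^- box_exponent k) `^ s)%:E)%E.
  apply: (hausdorff_premeasure_fin_cover 
    (F := fun m : {ffun 'I_n -> 'I_(2 ^ a k)} =>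
      box k (grid_point k (fun j => m j)))) => //.
  - by rewrite h2 mulr_ge0// ltW.
  - by move=> x /(_ k I).
  - by move=> m; exact: ediam_box.
rewrite lee_fin; apply: le_trans h1.
rewrite powRM// ?(ltW p0)// mulrCA ler_wpM2l//.
rewrite card_ffun !card_ord /r powRD; last by rewrite pnatr_eq0 implybT.
rewrite exprMn powR_mulrn// -exprM natrX natrX -exprM mulnC ler_wpM2l ?exprn_ge0//.
rewrite -[leRHS]powR_mulrn ?powR_ge0// -powRrM -powR_invn// -powRrM.
rewrite ler_powR ?ler1n//.
rewrite mulNr mulNr lerN2 mulrAC ler_wpM2r//.
rewrite /box_exponent natrD natrM; have := ler0n R k; lra.
Qed.

End cantor_set.

(** * Coding of points of the Cantor set by [0, 1[ *)

Definition digit (M c j : nat) := (c %/ M ^ j %% M)%N.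

Lemma digit_inj (M N c c' : nat) : (0 < M)%N ->
  (forall j, (j < N)%N -> digit M c j = digit M c' j) ->
  (c %% M ^ N = c' %% M ^ N)%N.
Proof.
move=> M0; elim: N => [|N IH] h; first by rewrite expn0 !modn1.
have e z : (z %% M ^ N.+1 = digit M z N * M ^ N + z %% M ^ N)%N.
  rewrite {1}(divn_eq z (M ^ N)) {1}(divn_eq (z %/ M ^ N) M) mulnDl -mulnA.
  rewrite -expnS -addnA modnMDl modn_small// expnS.
  apply: (@leq_trans ((digit M z N).+1 * M ^ N)).
    by rewrite mulSn addnC ltn_add2r ltn_pmod// expn_gt0 M0.
  by rewrite leq_mul2r ltn_pmod// orbT.
by rewrite !e h// IH// => j jN; rewrite h// ltnW.
Qed.

(** Nested intervals: every left end lies below every right end. *)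
Lemma nested_sup (R : realType) (l e : nat -> R) :
  (forall k, l k <= l k.+1) -> (forall k, l k.+1 + e k.+1 <= l k + e k) ->
  (forall k, 0 <= e k) ->
  forall k, l k <= sup (range l) <= l k + e k.
Proof.
move=> l_incr h_decr e0.
have lm : {homo l : i j / (i <= j)%N >-> i <= j}.
  by apply: homo_leq => // x y z; exact: le_trans.
have hm i j : (i <= j)%N -> l j + e j <= l i + e i.
  elim: j => [|j IH]; first by rewrite leqn0 => /eqP ->.
  by rewrite leq_eqVlt => /orP[/eqP ->//|/IH]; exact: le_trans.
have lub i k : l i <= l k + e k.
  have [ik|/ltnW ki] := leqP i k.
    by apply: (le_trans (lm _ _ ik)); rewrite lerDl.
  by apply: le_trans (hm _ _ ki); rewrite lerDl.
move=> k; apply/andP; split.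
  apply: ub_le_sup; last by exists k.
  by exists (l k + e k) => _ [i _ <-].
by apply: ge_sup => [|_ [i _ <-]//]; exists (l 0); exists 0.
Qed.

Section coding.
Context {R : realType} {n : nat}.
Variables (a : nat -> nat) (chi : nat -> 'rV[R]_n -> bool) (dir : nat -> 'I_n).
Hypothesis a_gt0 : (0 < a 0)%N.
Hypothesis a_growth :
  forall k, (k.+1 * (box_exponent a k + k.+1) <= a k.+1)%N.

Local Notation b := (box_exponent a).
Local Notation corner := (corner a chi dir).
Local Notation E := (cantor_set a chi dir).

Lemma a_boxS k : (b k + k.+1 <= a k.+1)%N.
Proof. by apply: leq_trans (a_growth k); rewrite leq_pmull. Qed.

Lemma a_ge1 k : (0 < a k)%N.
Proof. by case: k => // k; apply: leq_trans (a_boxS k); rewrite addnS. Qed.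

Lemma a_ge_id k : (k <= a k)%N.
Proof. by case: k => // k; apply: leq_trans (a_boxS k); rewrite leq_addl. Qed.

(** In each coordinate a box of stage [k] has length [2 ^ free_bits k] in units of the mesh of stage
    [k.+1]. *)
Definition free_bits k := (a k.+1 - b k)%N.

Fixpoint code_length k :=
  if k is k'.+1 then (code_length k' + n * free_bits k')%N else 0%N.

(** Numerators over [2 ^ a k] of a grid point. The lowest [n * free_bits k'] bits of [c] choose a
    cell of the previous box, one digit per coordinate; the higher bits code the previous grid
    point. Stage 0 is always the origin. *)
Fixpoint code_point k (c : nat) : 'I_n -> nat :=
  if k is k'.+1 then
    let m := code_point k' (c %/ 2 ^ (n * free_bits k')) in
    fun j => (m j * 2 ^ (a k - a k') +
      (if chi k' (grid_point a k' m) && (j == dir k')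
       then 2 ^ (a k - 5 * a k') else 0) +
      digit (2 ^ free_bits k') c j)%N
  else fun=> 0%N.

(** No carry occurs: the translation is at most half a coarse mesh and the digit is less than half,
    so a division recovers the previous numerators. *)
Lemma shift_digit_lt k (bo : bool) c j :
  ((if bo then 2 ^ (a k.+1 - 5 * a k) else 0) + digit (2 ^ free_bits k) c j
    < 2 ^ (a k.+1 - a k))%N.
Proof.
have h := a_boxS k; have h0 := a_ge1 k; rewrite /box_exponent in h.
apply: (@leq_trans (2 ^ (a k.+1 - 5 * a k) + 2 ^ free_bits k)).
  rewrite -addnS leq_add//; first by case: bo.
  by rewrite ltn_pmod// expn_gt0.
apply: (@leq_trans (2 ^ (a k.+1 - a k).-1 + 2 ^ (a k.+1 - a k).-1)).
  by rewrite leq_add// leq_exp2l// /free_bits /box_exponent; lia.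
by rewrite addnn -mul2n -expnS prednK//; lia.
Qed.

Lemma code_point_lt k c j : (code_point k c j < 2 ^ a k)%N.
Proof.
elim: k c j => [|k IH] c j; first by rewrite expn_gt0.
rewrite /=; set m := code_point k _; set bo := _ && _; rewrite -addnA.
apply: (@leq_trans ((m j).+1 * 2 ^ (a k.+1 - a k))).
  by rewrite mulSn addnC ltn_add2r shift_digit_lt.
rewrite (_ : 2 ^ a k.+1 = 2 ^ a k * 2 ^ (a k.+1 - a k))%N ?leq_mul2r ?IH ?orbT//.
by rewrite -expnD subnKC//; have := a_boxS k; rewrite /box_exponent; lia.
Qed.

Lemma code_point_inj k c c' : (c < 2 ^ code_length k)%N ->
  (c' < 2 ^ code_length k)%N -> code_point k c =1 code_point k c' -> c = c'.
Proof.
elim: k c c' => [|k IH] c c'; first by rewrite /= expn0 !ltnS !leqn0 => /eqP-> /eqP->.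
rewrite [code_length _]/= expnD => cl cl' h.
pose q := (2 ^ (n * free_bits k))%N; have q0 : (0 < q)%N by rewrite expn_gt0.
have D0 : (0 < 2 ^ (a k.+1 - a k))%N by rewrite expn_gt0.
have hm : code_point k (c %/ q) =1 code_point k (c' %/ q).
  move=> j; have := congr1 (fun z => z %/ 2 ^ (a k.+1 - a k))%N (h j).
  rewrite /= -!addnA !divnMDl// !(divn_small (shift_digit_lt _ _ _ _)).
  by rewrite !addn0.
have cq : (c %/ q = c' %/ q)%N by apply: IH => //; rewrite ltn_divLR.
rewrite (divn_eq c q) (divn_eq c' q) cq; congr addn.
rewrite /q mulnC expnM; apply: digit_inj => [|j jn]; first by rewrite expn_gt0.
(* Equal previous points get the same translation, which cancels and leaves the digits. *)
by have := h (Ordinal jn); rewrite /= -/q cq => /addnI.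
Qed.

Lemma pow2_subV (d m : nat) : (d <= m)%N ->
  (2 ^ (m - d))%:R / 2 ^+ m = 2 ^- d :> R.
Proof.
by move=> dm; rewrite natrX -{2}(subnK dm) exprD invfM mulrA divff ?mul1r.
Qed.

Lemma grid_code_pointS k c j :
  grid_point a k.+1 (code_point k.+1 c) ord0 j =
  corner k (grid_point a k (code_point k (c %/ 2 ^ (n * free_bits k)))) ord0 j +
  (digit (2 ^ free_bits k) c j)%:R / 2 ^+ a k.+1.
Proof.
have h := a_boxS k; rewrite /box_exponent in h.
rewrite cornerE /shift_size; set X := (grid_point a k _).
rewrite [LHS]mxE /=  -/X natrD mulrDl; congr (_ + _).
rewrite natrD mulrDl; congr (_ + _).
  by rewrite natrM -mulrA pow2_subV ?mxE//; lia.
case: (j == dir k); rewrite ?andbT ?andbF ?mul0r//.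
by case: (chi k X); rewrite ?mul0r// pow2_subV//; lia.
Qed.

(** For [t] in [0, 1[, its first [code_length k] binary digits read as an integer. *)
Definition stage_code k (t : R) := Num.truncn (2 ^+ code_length k * t).

Lemma stage_codeS k t : 0 <= t -> stage_code k t = (stage_code k.+1 t %/ 2 ^ (n * free_bits k))%N.
Proof.
move=> t0; have x0 : 0 <= 2 ^+ code_length k * t by rewrite mulr_ge0// exprn_ge0.
rewrite /stage_code [code_length k.+1]/= exprD mulrAC.
move: (_ * t) x0 => x x0; set q := (2 ^ (n * free_bits k))%N.
have q0 : (0 < q)%N by rewrite expn_gt0.
have qR : 2 ^+ (n * free_bits k) = q%:R :> R by rewrite natrX.
have qR0 : 0 < q%:R :> R by rewrite ltr0n.
rewrite qR; apply: truncn_def.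
have /truncn_itv/andP[h1 h2] : 0 <= x * q%:R by rewrite mulr_ge0.
apply/andP; split.
  rewrite -(ler_pM2r qR0) -natrM; apply: le_trans h1.
  by rewrite ler_nat leq_trunc_div.
rewrite -(ltr_pM2r qR0) -natrM; apply: (lt_le_trans h2).
by rewrite ler_nat ltn_ceil.
Qed.

Lemma stage_code_lt k t : 0 <= t < 1 -> (stage_code k t < 2 ^ code_length k)%N.
Proof.
move=> /andP[t0 t1]; rewrite truncn_lt_nat ?mulr_ge0 ?exprn_ge0//.
by rewrite natrX gtr_pMr// exprn_gt0.
Qed.

Definition code_corner t j k :=
  corner k (grid_point a k (code_point k (stage_code k t))) ord0 j.

(** The common point of the nested boxes selected by [t], whose lower corners increase in each
    coordinate. *)
Definition coded_point t : 'rV[R]_n := \row_j sup (range (code_corner t j)).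

(** A translated box stays in the cell of its grid point: both exponents exceed [a k], so each term
    is at most half a mesh. *)
Lemma pow2V_add k : 2 ^- (5 * a k) + 2 ^- b k <= 2 ^- a k :> R.
Proof.
have h0 := a_ge1 k.
have h m : ((a k).+1 <= m)%N -> 2 ^- m <= 2^-1 * 2 ^- a k :> R.
  move=> am; rewrite -invfM -exprS lef_pV2 ?posrE ?exprn_gt0//.
  by rewrite ler_weXn2l// ler1n.
have h1 : 2 ^- (5 * a k) <= 2^-1 * 2 ^- a k :> R by apply: h; lia.
have h2 : 2 ^- b k <= 2^-1 * 2 ^- a k :> R.
  by apply: h; rewrite /box_exponent; lia.
lra.
Qed.

Lemma coded_point_itv t k j : 0 <= t -> code_corner t j k <= coded_point t ord0 j <=
  code_corner t j k + 2 ^- b k.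
Proof.
move=> t0; rewrite mxE.
apply: (@nested_sup _ _ (fun k => 2 ^- b k)) => {}k.
- rewrite /code_corner (stage_codeS k t0).
  set c := stage_code k.+1 t; rewrite [leRHS]cornerE grid_code_pointS -addrA lerDl.
  rewrite addr_ge0 ?divr_ge0 ?exprn_ge0//.
  by case: ifP => // _; exact: shift_size_ge0.
- rewrite /code_corner (stage_codeS k t0).
  set c := stage_code k.+1 t; rewrite cornerE grid_code_pointS -!addrA lerD2l.
  set X := grid_point _ _ _; have h1 := pow2V_add k.+1.
  have h2 : (if j == dir k.+1 then shift_size a chi k.+1 X else 0) <=
      2 ^- (5 * a k.+1) :> R.
    by case: ifP => _; [exact: shift_size_le|rewrite invr_ge0 exprn_ge0].
  (* The digit plus one is at most [2 ^ free_bits k], so the whole chosen cell, and with it the next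
     box, fits into the previous box. *)
  have h3 : ((digit (2 ^ free_bits k) c j).+1)%:R / 2 ^+ a k.+1 <= 2 ^- b k :> R.
    rewrite -(@pow2_subV (b k) (a k.+1)); last by have := a_boxS k; lia.
    rewrite ler_pM2r ?invr_gt0 ?exprn_gt0// ler_nat.
    by rewrite ltn_pmod// expn_gt0.
  rewrite -addn1 natrD mulrDl mul1r in h3; lra.
- by rewrite invr_ge0 exprn_ge0.
Qed.

Lemma coded_point_cantor t : 0 <= t -> E (coded_point t).
Proof.
move=> t0 k _; exists [ffun j => Ordinal (code_point_lt k (stage_code k t) j)] => //.
move=> j; have := coded_point_itv k j t0; rewrite /code_corner.
suff -> : grid_point a k (fun j => [ffun j => Ordinal (code_point_lt k (stage_code k t) j)] j) =
  grid_point a k (code_point k (stage_code k t)) :> 'rV[R]_n by [].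
by apply/rowP => i; rewrite !mxE ffunE.
Qed.

Lemma coded_point_grid t k j : 0 <= t ->
  grid_point a k (code_point k (stage_code k t)) ord0 j <= coded_point t ord0 j <=
  grid_point a k (code_point k (stage_code k t)) ord0 j + 2 ^- a k.
Proof.
move=> t0; have := coded_point_itv k j t0; rewrite /code_corner cornerE.
set X := grid_point _ _ _; have h1 := pow2V_add k.
have h2 := shift_size_ge0 a chi k X; have h3 := shift_size_le a chi k X.
have h4 : 0 <= 2 ^- (5 * a k) :> R by rewrite invr_ge0 exprn_ge0.
by case: ifP => _; lra.
Qed.

End coding.

Lemma natr_sub_le_truncn (R : realType) (m m' : nat) (x : R) : 0 <= x ->
  m%:R - m'%:R <= x -> (m <= m' + Num.truncn x)%N.
Proof.
move=> x0 h; rewrite -leq_subLR truncn_ge_nat//.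
by have [mm|/ltnW mm] := leqP m m'; [move: mm; rewrite -subn_eq0 => /eqP ->|rewrite natrB].
Qed.

(** * Counting the codes of points in a small set *)

Section dimension.
Context {R : realType} {n : nat}.
Variables (a : nat -> nat) (chi : nat -> 'rV[R]_n -> bool) (dir : nat -> 'I_n).
Hypothesis a_gt0 : (0 < a 0)%N.
Hypothesis a_growth :
  forall k, (k.+1 * (box_exponent a k + k.+1) <= a k.+1)%N.

Local Notation b := (box_exponent a).
Local Notation E := (cantor_set a chi dir).
Local Notation J := (@code_length n a).
Local Notation coded_point := (coded_point a chi dir).
Local Notation code_point := (code_point a chi dir).
Local Notation stage_code := (@stage_code R n a).

(** A coded point lies at most one mesh above its grid point. Hence numerators of codes met by [V]
    differ by at most r 2^(a k) + 1 in each coordinate, and a code is determined by its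
    numerators. *)
Lemma card_code k (V : set 'rV[R]_n) r (P : pred 'I_(2 ^ J k)) : 0 <= r ->
  (forall x y, V x -> V y -> bounded_by r (x - y)) ->
  (forall c, P c -> exists t, [/\ 0 <= t, V (coded_point t) & stage_code k t = c]) ->
  #|P|%:R <= (2 * r * 2 ^+ a k + 3) ^+ n :> R.
Proof.
move=> r0 Vr HP; have [/eqP P0|] := posnP #|P|.
  by rewrite (eqP P0) exprn_ge0// addr_ge0// !mulr_ge0// exprn_ge0.
move=> /card_gt0P[c0 /HP[t0 [t00 Vt0 ct0]]].
pose x : R := r * 2 ^+ a k + 1; have x0 : 0 <= x by rewrite addr_ge0// mulr_ge0// exprn_ge0.
pose D := Num.truncn x; pose m0 := code_point k c0.
have near c j : P c -> (code_point k c j <= m0 j + D)%N /\ (m0 j <= code_point k c j + D)%N.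
  move=> /HP[t [t_ge0 Vt ct]].
  have := coded_point_grid chi dir a_gt0 a_growth k j t_ge0.
  have := coded_point_grid chi dir a_gt0 a_growth k j t00.
  have := Vr _ _ Vt Vt0 j; rewrite ct ct0 !mxE -/(m0 j).
  have A0 : 0 < 2 ^+ a k :> R by rewrite exprn_gt0.
  have e (z : R) : z = z * 2 ^+ a k / 2 ^+ a k by rewrite mulfK// gt_eqF.
  move: (sup _) (sup _) => y y0; rewrite (e y) (e y0) (e r) -mulrBl normrM.
  have em (m : R) : m / 2 ^+ a k + 2 ^- a k = (m + 1) / 2 ^+ a k by rewrite mulrDl mul1r.
  rewrite !em (@gtr0_norm _ (2 ^- a k)) ?invr_gt0// !ler_pM2r ?invr_gt0//.
  move: (y * _) (y0 * _) => {}y {}y0; rewrite ler_norml.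
  move=> h1 h2 h3.
  by split; apply: natr_sub_le_truncn => //; rewrite /x; lra.
(* Adding [D] first keeps the truncated subtraction exact and puts the result between 0 and 2 D. *)
pose f (c : 'I_(2 ^ J k)) : {ffun 'I_n -> 'I_(D.*2.+1)} :=
  [ffun j => inord (code_point k c j + D - m0 j)].
have f_inj : {in P &, injective f}.
  move=> c c' Pc Pc' /ffunP ff; apply: val_inj.
  apply: (code_point_inj (chi := chi) (dir := dir) a_gt0 a_growth (ltn_ord c) (ltn_ord c')) => j.
  have [h1 h2] := near c j Pc; have [h1' h2'] := near c' j Pc'.
  have := congr1 val (ff j); rewrite !ffunE /=.
  by rewrite !inordK; lia.
have : (#|P| <= (D.*2.+1) ^ n)%N.
  rewrite -(card_in_imset f_inj) (leq_trans (max_card _))//.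
  by rewrite card_ffun !card_ord.
rewrite -(ler_nat R) => /le_trans; apply; rewrite natrX.
apply: lerXn2r; rewrite ?nnegrE// ?addr_ge0// ?mulr_ge0// ?exprn_ge0//.
have : D%:R <= x by rewrite truncn_le.
by rewrite -addnn -addn1 !natrD /x; lra.
Qed.

(** [G] is the union of the dyadic intervals of the codes met by [V]; a measurable superset avoids
    discussing the measurability of the preimage of [V]. *)
Lemma code_measure k (V : set 'rV[R]_n) r : 0 <= r ->
  (forall x y, V x -> V y -> bounded_by r (x - y)) ->
  exists G : set R, [/\ measurable G,
    forall t, 0 <= t < 1 -> V (coded_point t) -> G t &
    (lebesgue_measure G <=
      ((2 * r * 2 ^+ a k + 3) ^+ n / 2 ^+ J k)%:E)%E].
Proof.
move=> r0 Vr.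
pose P c := `[< exists t, [/\ 0 <= t < 1, V (coded_point t) & stage_code k t = c] >].
pose I c : set R := `[c%:R / 2 ^+ J k, c.+1%:R / 2 ^+ J k[%classic.
pose A c := if P c then I c else set0.
have J0 : 0 < 2 ^+ J k :> R by rewrite exprn_gt0.
have mA c : measurable (A c).
  by rewrite /A; case: ifP => _; [exact: measurable_itv|exact: measurable0].
have hI c : (lebesgue_measure (I c) <= (2 ^- J k)%:E)%E.
  rewrite lebesgue_measure_itv/=; case: ifP => _; last by rewrite lee_fin invr_ge0 ltW.
  by rewrite -EFinB lee_fin -mulrBl -natrB// subSnn mul1r.
exists (\big[setU/set0]_(c < 2 ^ J k) A c); split.
- by apply: bigsetU_measurable => c _; exact: mA.
- move=> t t01 Vt; have /andP[t0 _] := t01.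
  rewrite -bigcup_mkord; exists (stage_code k t); first exact: stage_code_lt.
  have Pt : P (stage_code k t) by apply/asboolP; exists t.
  rewrite /A Pt /I /= in_itv/= ler_pdivrMr// ltr_pdivlMr// ![t * _]mulrC.
  by apply: truncn_itv; rewrite mulr_ge0// exprn_ge0.
- apply: (le_trans (Boole_inequality _ _)) => [c _|]; first exact: mA.
  apply: (@le_trans _ _ (\sum_(c < 2 ^ J k | P c) (2 ^- J k)%:E)%E).
    rewrite [leRHS]big_mkcond; apply: lee_sum => c _; rewrite /A.
    by case: ifP => _; [exact: hI|rewrite measure0].
  rewrite sumEFin lee_fin sumr_const -[X in X <= _]mulr_natl ler_pM2r ?invr_gt0//.
  apply: (card_code r0 Vr) => c /asboolP[t [/andP[t0 _] Vt ct]].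
  by exists t.
Qed.

(** J_(k+1) is at least n (a_(k+1) - b_k) and b_(k+1) = 8 a_(k+1) + k + 1, where the growth
    condition makes b_k + k + 1 at most a_(k+1) / (k + 1). *)
Lemma code_length_ge (s : R) : 0 <= s < n%:R / 8 ->
  exists K, forall k, (K <= k)%N -> s * (b k)%:R <= (J k)%:R.
Proof.
move=> /andP[s0 sn].
have n8s : 0 < n%:R - 8 * s by rewrite subr_gt0 mulrC -ltr_pdivlMr.
pose K := Num.bound ((n%:R + s) / (n%:R - 8 * s)).
have hK : (n%:R + s) / (n%:R - 8 * s) < K%:R.
  by apply: archi_boundP; rewrite divr_ge0 ?(ltW n8s)// addr_ge0.
exists K.+1 => -[//|k] Kk.
have {hK} hk : n%:R + s <= k.+1%:R * (n%:R - 8 * s).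
  rewrite -ler_pdivrMr//; apply/ltW/(lt_le_trans hK); rewrite ler_nat.
  by apply: leq_trans Kk; rewrite leqnSn.
have h1 : (k.+1%:R * ((b k)%:R + k.+1%:R) <= (a k.+1)%:R :> R).
  by rewrite -natrD -natrM ler_nat a_growth.
have h2 : (n%:R * ((a k.+1)%:R - (b k)%:R) <= (J k.+1)%:R :> R).
  rewrite -natrB -?natrM ?ler_nat ?leq_addl//.
  by apply: leq_trans (a_boxS a_growth k); rewrite leq_addr.
apply: le_trans h2; rewrite {1}/box_exponent natrD natrM.
move: hk h1; move: (k.+1%:R : R) (ltr0Sn R k) ((b k)%:R : R) (ler0n R (b k)) ((a k.+1)%:R : R).
move=> m m0 c c0 A h h1; rewrite -(ler_pM2l m0).
have h3 : (n%:R + s) * (m * (c + m)) <= (n%:R + s) * A.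
  by rewrite ler_wpM2l// addr_ge0.
have A0 : 0 <= A by apply: le_trans h1; rewrite mulr_ge0// ?addr_ge0// ltW.
have h4 : (n%:R + s) * A <= m * (n%:R - 8 * s) * A by rewrite ler_wpM2r.
have h5 : 0 <= m * (s * c + n%:R * m) by rewrite mulr_ge0 ?addr_ge0// ?mulr_ge0// ltW.
by have := le_trans h3 h4; nra.
Qed.

Lemma code_lengthS k : (J k.+1 = J k + n * (a k.+1 - b k))%N.
Proof. by []. Qed.

Lemma scale_bound (s : R) : 0 <= s < n%:R / 8 -> exists C, 0 < C /\
  forall r, 0 < r <= 1 ->
    exists k, (2 * r * 2 ^+ a k + 3) ^+ n / 2 ^+ J k <= C * r `^ s.
Proof.
move=> s0n; have [K hK] := code_length_ge s0n; have /andP[s0 sn] := s0n.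
have sn1 : s <= n%:R by have := ler0n R n; lra.
have P1 m : 1 <= 2 ^+ m :> R by rewrite exprn_ege1// ler1n.
have P0 m : 0 < 2 ^+ m :> R by exact: lt_le_trans (P1 m).
have ge1_powR (z : R) : 1 <= z -> 1 <= z `^ s.
  move=> z1; rewrite -[leLHS](congr1 (fun f => f s) (powR1 R)).
  by apply: ge0_ler_powR; rewrite ?nnegrE// (le_trans ler01).
have powJ k : (K <= k)%N -> 2 `^ (s * (b k)%:R) <= 2 ^+ J k :> R.
  by move=> /hK h; rewrite -powR_mulrn// ler_powR// ler1n.
have powb (r : R) k : 0 < r -> (r * 2 ^+ b k) `^ s = r `^ s * 2 `^ (s * (b k)%:R).
  by move=> r0; rewrite powRM ?(ltW r0)// ?(ltW (P0 _))// -powR_mulrn// -powRrM [_%:R * s]mulrC.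
pose C0 : R := (2 * 2 ^+ a 0 + 3) ^+ n * 2 `^ (s * (b K)%:R).
have C00 : 0 <= C0.
  apply: mulr_ge0 (powR_ge0 _ _); apply: exprn_ge0.
  by have := P0 (a 0); lra.
exists (5 ^+ n + C0); split; first by rewrite ltr_wpDr// exprn_gt0.
move=> r /andP[r0 r1].
have rs0 : 0 <= r `^ s := powR_ge0 _ _.
(* For large radii stage 0, with its single code, suffices: [C0] absorbs the loss. *)
have [rK|Kr] := leP 1 (r * 2 ^+ b K).
  exists 0%N; rewrite /= expr0 divr1.
  apply: (@le_trans _ _ (C0 * r `^ s)); last by rewrite ler_wpM2r// lerDr exprn_ge0.
  rewrite /C0 -[leRHS]mulrA [_ * r `^ s]mulrC -powb// -[leLHS]mulr1 ler_pM//.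
  - by rewrite exprn_ge0// addr_ge0// !mulr_ge0// ltW.
  - apply: lerXn2r; rewrite ?nnegrE ?addr_ge0 ?mulr_ge0 ?(ltW (P0 _)) ?(ltW r0)//.
    by rewrite lerD2r -mulrA ler_pM2l// ler_piMl// ltW.
  - exact: ge1_powR.
(* Otherwise [r] lies between the box sides of two consecutive stages, and the finer one is used. *)
have [k [Kk kr rk]] : exists k, [/\ (K <= k)%N, r * 2 ^+ b k < 1 & 1 <= r * 2 ^+ b k.+1].
  have ex : exists j, 1 <= r * 2 ^+ b (K + j).
    have [m hm] : exists m : nat, r^-1 < m%:R.
      by exists (Num.bound r^-1); apply: archi_boundP; rewrite invr_ge0 ltW.
    exists m; rewrite -ler_pdivrMl// mulr1; apply/ltW/(lt_le_trans hm).
    rewrite -natrX ler_nat; apply: (@leq_trans (2 ^ m)); first exact/ltnW/ltn_expl.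
    by rewrite leq_exp2l// /box_exponent; lia.
  case: (ex_minnP ex) => -[|j]; first by rewrite addn0 leNgt Kr.
  move=> hj minj; exists (K + j)%N; rewrite leq_addr -addnS hj ltNge; split=> //.
  by apply/negP => /minj; rewrite ltnn.
exists k.+1.
apply: (@le_trans _ _ (5 ^+ n * r `^ s)); last by rewrite ler_wpM2r// lerDl.
(* Above the mesh, the count is at most (5 r 2^(a_(k+1)))^n and the quotient becomes (5 r 2^(b_k))^n
   / 2^(J_k). As r 2^(b_k) < 1, its exponent n may be lowered to s. *)
have [ar|ra] := leP 1 (r * 2 ^+ a k.+1).
  rewrite code_lengthS exprD mulnC exprM.
  have fe : 2 ^+ (a k.+1 - b k) = 2 ^+ a k.+1 / 2 ^+ b k :> R.
    have bk : (b k <= a k.+1)%N by apply: leq_trans (a_boxS a_growth k); rewrite leq_addr.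
    by rewrite -{2}(subnK bk) exprD mulfK// gt_eqF.
  rewrite fe invfM mulrCA -(exprVn (_ / _)) -exprMn invf_div [leLHS]mulrC.
  apply: (@le_trans _ _ ((5 * (r * 2 ^+ b k)) ^+ n / 2 ^+ J k)).
    rewrite ler_pM2r ?invr_gt0//.
    have h1 : 0 <= (2 * r * 2 ^+ a k.+1 + 3) * (2 ^+ b k / 2 ^+ a k.+1).
      by rewrite mulr_ge0 ?divr_ge0 ?addr_ge0 ?mulr_ge0 ?(ltW r0) ?(ltW (P0 _)).
    have h2 : 0 <= 5 * (r * 2 ^+ b k) by rewrite !mulr_ge0 ?(ltW r0) ?(ltW (P0 _)).
    have h3 : (2 * r * 2 ^+ a k.+1 + 3) * (2 ^+ b k / 2 ^+ a k.+1) <=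
        5 * (r * 2 ^+ b k).
      rewrite [leLHS]mulrA ler_pdivrMr//.
      rewrite (_ : 5 * _ * _ = 5 * (r * 2 ^+ a k.+1) * 2 ^+ b k); last by ring.
      by rewrite ler_pM2r// -[2 * r * _]mulrA; move: (r * _) ar => z; lra.
    by apply: lerXn2r; rewrite ?nnegrE.
  rewrite exprMn -mulrA ler_pM2l ?exprn_gt0// ler_pdivrMr//.
  apply: (@le_trans _ _ ((r * 2 ^+ b k) `^ s)).
    rewrite -powR_mulrn ?mulr_ge0 ?(ltW r0) ?(ltW (P0 _))//.
    by apply: ger_powR => //; rewrite mulr_gt0//= ltW.
  by rewrite powb// ler_wpM2l// powJ.
(* Below the mesh there are at most 5^n codes, and 2^-(J_(k+1)) <= 2^-(s b_(k+1)) <= r^s. *)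
apply: ler_pM; rewrite ?exprn_ge0 ?invr_ge0 ?addr_ge0 ?mulr_ge0 ?(ltW r0) ?(ltW (P0 _))//.
  apply: lerXn2r; rewrite ?nnegrE ?addr_ge0 ?mulr_ge0 ?(ltW r0) ?(ltW (P0 _))//.
  by rewrite -mulrA; move: (r * _) ra => z; lra.
apply: (@le_trans _ _ ((2 `^ (s * (b k.+1)%:R))^-1)).
  by rewrite lef_pV2 ?posrE ?powR_gt0// powJ// leqW.
rewrite -[leLHS]mul1r ler_pdivrMr ?powR_gt0// -powb//.
exact: ge1_powR.
Qed.

End dimension.

(** * Comparison with Lebesgue measure and the Hausdorff dimension *)

Section hausdorff_dimension.
Context {R : realType} {n : nat}.
Variables (a : nat -> nat) (chi : nat -> 'rV[R]_n -> bool) (dir : nat -> 'I_n).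
Hypothesis a_gt0 : (0 < a 0)%N.
Hypothesis a_growth :
  forall k, (k.+1 * (box_exponent a k + k.+1) <= a k.+1)%N.

Local Notation E := (cantor_set a chi dir).
Local Notation coded_point := (coded_point a chi dir).

(** Mass distribution principle: the parameters coded into [V] have outer measure at most [C] times
    the weight of [V]. *)
Lemma weight_covers_code (s : R) : 0 <= s < n%:R / 8 -> exists C, 0 < C /\
  forall V : set 'rV[R]_n, (ediam V <= 1)%E -> exists G : set R,
    [/\ measurable G, forall t, 0 <= t < 1 -> V (coded_point t) -> G t &
    (lebesgue_measure G <= C%:E * hausdorff_weight s V)%E].
Proof.
move=> s0n; have [C [C0 hC]] := scale_bound a_gt0 a_growth s0n.
have /andP[s0 _] := s0n.
exists C; split=> // V V1; rewrite /hausdorff_weight.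
case: ifPn => [/eqP ->|_].
  by exists set0; split=> //; rewrite measure0 mule0.
have Vfin : ediam V \is a fin_num.
  by rewrite ge0_fin_numE ?ediam_ge0// (le_lt_trans V1)// ltey.
have [d dE] : exists d, ediam V = d%:E by exists (fine (ediam V)); rewrite fineK.
have d0 : 0 <= d by rewrite -lee_fin -dE ediam_ge0.
have d1 : d <= 1 by rewrite -lee_fin -dE.
have Vd x y : V x -> V y -> bounded_by d (x - y).
  move=> Vx Vy j; rewrite -lee_fin -dE; apply: le_trans (ediam_ge Vx Vy).
  by rewrite lee_fin enorm_ge_coord.
have Vr r : 0 < r <= 1 -> d <= r -> exists G : set R,
    [/\ measurable G, forall t, 0 <= t < 1 -> V (coded_point t) -> G t &
    (lebesgue_measure G <= (C * r `^ s)%:E)%E].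
  move=> r01 dr; have /andP[r0 _] := r01; have [k hk] := hC r r01.
  have Vr x y : V x -> V y -> bounded_by r (x - y).
    by move=> Vx Vy; apply: bounded_byW dr _; exact: Vd.
  have [G [mG cG lG]] := code_measure chi dir a_gt0 a_growth k (ltW r0) Vr.
  by exists G; split=> //; apply: (le_trans lG); rewrite lee_fin.
rewrite dE poweR_EFin -EFinM.
have [dpos|] := ltP 0 d; first by apply: Vr => //; rewrite dpos.
move=> d_le0; have {}d0 : d = 0 by apply/eqP; rewrite eq_le d_le0.
(* Diameter 0 is outside the range of [scale_bound]. For [s = 0] the weight is 1 and radius 1 will
   do; for [s > 0] it is 0, and covers for the radii (m + 1)^(-1/s) are intersected to get a null
   set. *)
have [s_eq0|s_neq0] := eqVneq s 0.
  have := Vr 1; rewrite s_eq0 !powRr0; apply => //.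
  by rewrite ltr01 lexx.
have spos : 0 < s by rewrite lt_neqAle eq_sym s_neq0.
have Vm (m : nat) : exists G : set R,
    [/\ measurable G, forall t, 0 <= t < 1 -> V (coded_point t) -> G t &
    (lebesgue_measure G <= (C * m.+1%:R^-1)%:E)%E].
  have m0 : 0 < m.+1%:R^-1 :> R by rewrite invr_gt0.
  have m1 : m.+1%:R^-1 <= 1 :> R by rewrite invf_le1// ler1n.
  have := Vr (m.+1%:R^-1 `^ s^-1); rewrite -powRrM mulVf// powRr1 ?(ltW m0)//.
  apply; last by rewrite d0 powR_ge0.
  rewrite powR_gt0//= -[leRHS](congr1 (fun f => f s^-1) (powR1 R)).
  by apply: ge0_ler_powR; rewrite ?nnegrE ?invr_ge0// ltW.
have /choice[G hG] := Vm.
have mG : measurable (\bigcap_m G m) by apply: bigcapT_measurable => m; have [] := hG m.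
exists (\bigcap_m G m); split=> //.
  by move=> t t01 Vt m _; have [_ + _] := hG m; exact.
rewrite d0 powR0// mulr0; apply/lee_addgt0Pr => e e0; rewrite add0e.
pose m := Num.bound (C / e).
have hm : C / e < m%:R by apply: archi_boundP; rewrite divr_ge0 ?ltW.
have [mGm _ lG] := hG m.
apply: (@le_trans _ _ (lebesgue_measure (G m))).
  by apply: le_measure; rewrite ?inE//; exact: bigcap_inf.
apply: (le_trans lG); rewrite lee_fin ler_pdivrMr// mulrC -ler_pdivrMr//.
by apply/ltW/(lt_le_trans hm); rewrite ler_nat.
Qed.

(** A cover of the Cantor set pulls back to a cover of [0, 1[, so its total weight is at least 1 /
    C. *)
Lemma hausdorff_measure_cantor_gt0 (s : R) : 0 <= s < n%:R / 8 ->
  (0 < hausdorff_measure s E)%E.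
Proof.
move=> s0n; have [C [C0 hC]] := weight_covers_code s0n.
suff h : ((C^-1)%:E <= hausdorff_premeasure s 1 E)%E.
  apply: (@lt_le_trans _ _ (C^-1)%:E); first by rewrite lte_fin invr_gt0.
  by apply: (le_trans h); apply: ereal_sup_ubound; exists 1 => //=.
apply: le_ereal_inf_tmp => _ [U [EU U1] <-].
have /choice[G hG] := fun k => hC (U k) (U1 k).
have : (lebesgue_measure [set` `[0%R : R, 1%R[] <= \sum_(k <oo) lebesgue_measure (G k))%E.
  apply: measure_sigma_subadditive => [k||t].
  - by have [] := hG k.
  - exact: measurable_itv.
  - rewrite /= in_itv/= => t01; have /andP[t0 _] := t01.
    have [k _ Ukt] := EU _ (coded_point_cantor chi dir a_gt0 a_growth t0).
    by exists k => //; have [_ + _] := hG k; exact.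
rewrite lebesgue_measure_itv/= lte_fin ltr01 -EFinB subr0 => h.
have : (1 <= C%:E * \sum_(k <oo) hausdorff_weight s (U k))%E.
  rewrite -nneseriesZl; last by move=> k _; exact: hausdorff_weight_ge0.
  apply: (le_trans h); apply: lee_nneseries => [k _ _|k _]; last by have [] := hG k.
  exact: measure_ge0.
by rewrite -lee_pdivrMl// mule1.
Qed.

Lemma hausdorff_dim_cantor : hausdorff_dim E = (n%:R / 8)%:E.
Proof.
apply/eqP; rewrite eq_le; apply/andP; split.
  apply/lee_addgt0Pr => e e0; apply: ereal_inf_lbound; exists (n%:R / 8 + e) => //.
  split; first by rewrite addr_ge0 ?divr_ge0// ltW.
  apply: hausdorff_measure_cantor_eq0; last by rewrite ltrDl.
  exact: a_ge_id.
apply: le_ereal_inf_tmp => _ [s [s0 Es] <-]; rewrite lee_fin leNgt; apply/negP => sn.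
by have := hausdorff_measure_cantor_gt0 (s := s); rewrite s0 sn Es ltxx => /(_ isT).
Qed.

End hausdorff_dimension.

(** * Avoiding a single angle *)

Definition rational_real (R : realType) (t : R) :=
  exists p q : int, 0 < q /\ q%:~R * t = p%:~R.

(** The conclusion of [irrational_gap] for c = n^2: with N = 2 ^ a, the number n^2 N^4 bounds N^4
    |U|^2 |W|^2 for lattice differences U and W. *)
Definition gap_at (R : realType) (n : nat) (t : R) (a : nat) :=
  forall p q : int, 0 < q -> q%:~R <= n%:R ^+ 2 * 16 ^+ a :> R ->
    (32 * (n%:R ^+ 2 * 16 ^+ a))^-1 <= `|q%:~R * t - p%:~R|.

Section avoidance.
Context {R : realType} {n : nat}.
Variables (a : nat -> nat) (chi : nat -> 'rV[R]_n -> bool) (dir : nat -> 'I_n).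
Hypothesis a_gt0 : (0 < a 0)%N.
Hypothesis a_growth :
  forall k, (k.+1 * (box_exponent a k + k.+1) <= a k.+1)%N.

Local Notation b := (box_exponent a).
Local Notation E := (cantor_set a chi dir).
Local Notation corner := (corner a chi dir).

(** Two precisions: [x] is within a box side of the corner, but only within a mesh of [X]. As [chi]
    is evaluated at [X], later conditions on it concern all points within a mesh. *)
Record grid_approx k (x X : 'rV[R]_n) : Prop := GridApprox {
  ga_lattice : on_lattice (2 ^ a k) X ;
  ga_itv : forall j, 0 <= X ord0 j <= 1 ;
  ga_corner : forall j,
    corner k X ord0 j <= x ord0 j <= corner k X ord0 j + 2 ^- b k ;
  ga_near : near_by (2 ^- a k) x X }.

Lemma cantor_approx k x : E x -> exists X, grid_approx k x X.
Proof.
move=> /(_ k I)[m _ xm]; exists (grid_point a k (fun j => m j)).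
have A0 : 0 < 2 ^+ a k :> R by rewrite exprn_gt0.
split=> // [j|j|j].
- by rewrite mxE natrX mulrCA divff ?mulr1 ?natr_int// gt_eqF.
- exact: grid_point_itv.
- have := xm j; rewrite cornerE; set X := grid_point _ _ _.
  have h1 := pow2V_add (R := R) a_gt0 a_growth k.
  have h2 := shift_size_ge0 a chi k X; have h3 := shift_size_le a chi k X.
  have h4 : 0 <= 2 ^- (5 * a k) :> R by rewrite invr_ge0 exprn_ge0.
  by case: ifP => _ h; rewrite ler_norml; lra.
Qed.

Lemma cantor_itv x j : E x -> 0 <= x ord0 j <= 1.
Proof.
move=> /(_ 0%N I)[m _ /(_ j)]; rewrite cornerE; set X := grid_point _ _ _.
have h1 := pow2V_add (R := R) a_gt0 a_growth 0.
have h2 := shift_size_ge0 a chi 0 X; have h3 := shift_size_le a chi 0 X.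
have h4 : 0 <= 2 ^- (5 * a 0) :> R by rewrite invr_ge0 exprn_ge0.
have A0 : 0 < 2 ^+ a 0 :> R by rewrite exprn_gt0.
have X0 : 0 <= X ord0 j by rewrite mxE divr_ge0// ltW.
have X1 : X ord0 j + 2 ^- a 0 <= 1.
  have e (z : R) : z / 2 ^+ a 0 + 2 ^- a 0 = (z + 1) / 2 ^+ a 0.
    by rewrite mulrDl mul1r.
  by rewrite mxE e ler_pdivrMr// mul1r -natrX natr1 ler_nat.
by case: ifP => _ h; lra.
Qed.

Lemma cantor_bounded x y : E x -> E y -> bounded_by 1 (x - y).
Proof.
move=> Ex Ey j; have := cantor_itv j Ex; have := cantor_itv j Ey.
by rewrite !mxE ler_norml; lra.
Qed.

Lemma grid_bounded k x y X Y : grid_approx k x X -> grid_approx k y Y ->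
  bounded_by 1 (X - Y).
Proof.
move=> xX yY j; have := ga_itv xX j; have := ga_itv yY j.
by rewrite !mxE ler_norml; lra.
Qed.

Lemma grid_near k x y X Y : grid_approx k x X -> grid_approx k y Y ->
  chi k Y = false ->
  near_by (2 ^- b k) (x - y) (X - Y + shift_size a chi k X *: delta_mx ord0 (dir k)).
Proof.
move=> xX yY cY j; have := ga_corner xX j; have := ga_corner yY j.
rewrite /corner /shift_size cY scale0r addr0 !mxE ler_norml; case: ifP => _; lra.
Qed.

Lemma box_exponentE k :
  2 ^- b k = ((2 ^ a k)%:R ^+ 8 * 2 ^+ k)^-1 :> R.
Proof. by rewrite /box_exponent exprD natrX -exprM mulnC. Qed.

(** At infinitely many stages [p] alone is translated, along [i], and [shift_form_avoid] then rules
    out a nonzero derivative. *)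
Lemma cantor_avoid_shift_form i f D (C c : R) p q r s :
  shift_form i f D C c -> E p -> E q -> E r -> E s ->
  (forall K, exists k, [/\ (K <= k)%N, dir k = i,
    forall X, near_by (2 ^- a k) p X -> chi k X &
    forall x X, x = q \/ x = r \/ x = s -> near_by (2 ^- a k) x X ->
      chi k X = false]) ->
  f (p - q) (r - s) = 0 -> D (p - q) (r - s) = 0.
Proof.
move=> sf Ep Eq Er Es sep f0; apply/eqP; apply: contrapT => /negP D0.
have [K hK] := shift_form_avoid sf (cantor_bounded Ep Eq) (cantor_bounded Er Es) f0 D0.
have [k [Kk dk cp cqrs]] := sep K.
have [P pP] := cantor_approx k Ep; have [Q qQ] := cantor_approx k Eq.
have [S rS] := cantor_approx k Er; have [T sT] := cantor_approx k Es.
have cQ : chi k Q = false by apply: (cqrs q); [left|exact: ga_near qQ].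
have cS : chi k S = false by apply: (cqrs r); [right; left|exact: ga_near rS].
have cT : chi k T = false by apply: (cqrs s); [right; right|exact: ga_near sT].
apply: (hK k (2 ^ a k)%N (P - Q) (S - T)) => //.
- by rewrite leq_exp2l// (a_ge_id a_growth).
- exact: grid_bounded pP qQ.
- exact: grid_bounded rS sT.
- by apply: on_latticeB; [exact: ga_lattice pP|exact: ga_lattice qQ].
- by apply: on_latticeB; [exact: ga_lattice rS|exact: ga_lattice sT].
- have := grid_near pP qQ cQ; rewrite /shift_size (cp P (ga_near pP)) dk.
  have e5 : 2 ^- (5 * a k) = (2 ^ a k)%:R ^- 5 :> R.
    by rewrite natrX -exprM mulnC.
  by rewrite box_exponentE e5.
- have := grid_near rS sT cT; rewrite /shift_size cS scale0r addr0.
  by rewrite box_exponentE.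
Qed.

Lemma row_neq0 (u : 'rV[R]_n) : u != 0 -> exists j, u ord0 j != 0.
Proof.
move=> u0; apply: contrapT => nj; move/negP: u0; apply; apply/eqP/rowP => j.
by rewrite mxE; apply: contrapT => uj; apply: nj; exists j; apply/eqP.
Qed.

(** At an untranslated stage the gap bounds |F_t| at the lattice vectors below by a multiple of
    N^-8, while closeness to a zero bounds it above by 64 n^2 N^-8 2^-k. *)
Lemma cantor_avoid_irrational (t : R) p q r s : 0 <= t <= 1 ->
  E p -> E q -> E r -> E s -> p != q -> r != s ->
  (forall K, exists k, [/\ (K <= k)%N, forall X, chi k X = false &
    gap_at n t (a k)]) ->
  angle_form t (p - q) (r - s) <> 0.
Proof.
move=> t01 Ep Eq Er Es pq rs gap F0.
have /row_neq0[j uj] : p - q != 0 by rewrite subr_eq0.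
have /row_neq0[l wl] : r - s != 0 by rewrite subr_eq0.
have bu := cantor_bounded Ep Eq; have bw := cantor_bounded Er Es.
have nn : 1 <= n%:R :> R by rewrite ler1n; case: n j {l uj wl bu bw} => // -[].
have h01 : 0 <= (2^-1 : R) < 1 by lra.
have uj0 : 0 < `|(p - q) ord0 j| by rewrite normr_gt0.
have wl0 : 0 < `|(r - s) ord0 l| by rewrite normr_gt0.
(* [K1] and [K2] make the lattice vectors nonzero, hence the denominator [B] positive; [K3] makes
   the Lipschitz error smaller than the gap. *)
have [K1 hK1] := expr_eventually_lt h01 uj0.
have [K2 hK2] := expr_eventually_lt h01 wl0.
have nn0 : 0 < n%:R :> R := lt_le_trans ltr01 nn.
have n20 : 0 < n%:R ^+ 2 :> R by rewrite exprn_gt0.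
have n40 : 0 < (64 * n%:R ^+ 2 * (32 * n%:R ^+ 2))^-1 :> R.
  by rewrite invr_gt0 !pmulr_rgt0.
have [K3 hK3] := expr_eventually_lt h01 n40.
have [k [Kk chi0 gapk]] := gap (maxn K1 (maxn K2 K3)).
move: Kk; rewrite !geq_max => /and3P[/hK1 h1 /hK2 h2 /hK3 h3].
have [P pP] := cantor_approx k Ep; have [Q qQ] := cantor_approx k Eq.
have [S rS] := cantor_approx k Er; have [T sT] := cantor_approx k Es.
have nu := grid_near pP qQ (chi0 Q); have nw := grid_near rS sT (chi0 T).
rewrite /shift_size !chi0 !scale0r !addr0 in nu nw.
set N := (2 ^ a k)%N; have N0 : 0 < N%:R :> R by rewrite ltr0n expn_gt0.
have N4 : N%:R ^+ 4 = 16 ^+ a k :> R.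
  by rewrite natrX -exprM mulnC exprM; congr (_ ^+ _); rewrite -natrX.
have N1 : 1 <= N%:R :> R by rewrite ler1n expn_gt0.
have rho : 2 ^- b k = (N%:R ^+ 8)^-1 * 2^-1 ^+ k :> R.
  by rewrite box_exponentE invfM exprVn.
have rho_le : 2 ^- b k <= 2^-1 ^+ k :> R.
  rewrite rho ler_piMl ?exprn_ge0 ?invr_ge0// invf_le1 ?exprn_gt0//.
  by rewrite exprn_ege1.
have LU : on_lattice N (P - Q).
  by apply: on_latticeB; [exact: ga_lattice pP|exact: ga_lattice qQ].
have LW : on_lattice N (S - T).
  by apply: on_latticeB; [exact: ga_lattice rS|exact: ga_lattice sT].
have bU := grid_bounded pP qQ; have bW := grid_bounded rS sT.
have U0 : 0 < dotr (P - Q) (P - Q).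
  rewrite lt_neqAle dotr_ge0 andbT eq_sym dotr_eq0; apply/eqP => U0.
  have := nu j; rewrite U0 [(0 : 'rV_n) _ _]mxE subr0 leNgt => /negP; apply.
  exact: le_lt_trans rho_le h1.
have W0 : 0 < dotr (S - T) (S - T).
  rewrite lt_neqAle dotr_ge0 andbT eq_sym dotr_eq0; apply/eqP => W0.
  have := nw l; rewrite W0 [(0 : 'rV_n) _ _]mxE subr0 leNgt => /negP; apply.
  exact: le_lt_trans rho_le h2.
have b2 (v : 'rV[R]_n) : bounded_by 1 v -> bounded_by 2 v by apply: bounded_byW; lra.
have := angle_form_lipschitz t01 (b2 _ bu) (b2 _ bU) (b2 _ bw) (b2 _ bW) nu nw.
rewrite F0 sub0r normrN leNgt => /negP; apply.
have /intrP[A hA] : (N%:R ^+ 2 * dotr (P - Q) (S - T)) ^+ 2 \is a Num.int.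
  by rewrite rpredX// lattice_dotr.
have /intrP[B hB] : (N%:R ^+ 2 * dotr (P - Q) (P - Q)) *
    (N%:R ^+ 2 * dotr (S - T) (S - T)) \is a Num.int.
  by rewrite rpredM// lattice_dotr.
have B0 : 0 < B by rewrite -(ltr0z R) -hB !mulr_gt0// exprn_gt0.
have BM : B%:~R <= n%:R ^+ 2 * 16 ^+ a k :> R.
  have dU := le_trans (ler_norm _) (dotr_bound bU bU).
  have dW := le_trans (ler_norm _) (dotr_bound bW bW).
  rewrite -hB -N4 (_ : _ * _ = dotr (P - Q) (P - Q) * dotr (S - T) (S - T) *
    N%:R ^+ 4); last by ring.
  rewrite ler_pM2r ?exprn_gt0// expr2; rewrite !mulr1 in dU dW.
  by apply: ler_pM => //; exact: ltW.
have := gapk A B B0 BM; rewrite -N4 -hA -hB.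
rewrite (_ : _ - _ = - (N%:R ^+ 4 * angle_form t (P - Q) (S - T))); last first.
  by rewrite /angle_form; ring.
rewrite normrN normrM ger0_norm ?exprn_ge0// => hgap.
rewrite -(ltr_pM2l (exprn_gt0 4 N0)); apply: lt_le_trans hgap.
rewrite rho (_ : N%:R ^+ 4 * (64 * _ * _) =
  64 * n%:R ^+ 2 * N%:R ^- 4 * 2^-1 ^+ k); last by field; rewrite gt_eqF.
rewrite (_ : (32 * _)^-1 = 64 * n%:R ^+ 2 * N%:R ^- 4 *
  (64 * n%:R ^+ 2 * (32 * n%:R ^+ 2))^-1); last by field; rewrite !gt_eqF.
by rewrite ltr_pM2l// !pmulr_rgt0// invr_gt0 exprn_gt0.
Qed.

(** Equality in Cauchy-Schwarz: the residual of the projection of [u] on [w] has norm 0. *)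
Lemma dotr_collinear (u w : 'rV[R]_n) : w != 0 -> angle_form 1 u w = 0 ->
  exists c, u = c *: w.
Proof.
rewrite -dotr_eq0 /angle_form mul1r => w0 /eqP; rewrite subr_eq0 => /eqP h.
pose c := dotr u w / dotr w w; exists c; apply/eqP.
rewrite -subr_eq0 -dotr_eq0; apply/eqP.
have dE v : dotr (u - c *: w) v = dotr u v - c * dotr w v.
  rewrite /dotr mulr_sumr -sumrB; apply: eq_bigr => j _; rewrite !mxE; ring.
rewrite dE (dotrC u) (dotrC w) !dE (dotrC w u) /c.
have -> : dotr u u = dotr u w ^+ 2 / dotr w w by rewrite h mulfK.
by field.
Qed.

Lemma cantor_avoid_angle (t : R) p q r s : (2 <= n)%N -> 0 <= t <= 1 ->
  E p -> E q -> E r -> E s -> p != q -> r != s ->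
  (~ rational_real t -> forall K, exists k, [/\ (K <= k)%N,
    forall X, chi k X = false & gap_at n t (a k)]) ->
  (forall i K, exists k, [/\ (K <= k)%N, dir k = i,
    forall X, near_by (2 ^- a k) p X -> chi k X &
    forall x X, x = q \/ x = r \/ x = s -> near_by (2 ^- a k) x X ->
      chi k X = false]) ->
  angle_form t (p - q) (r - s) <> 0.
Proof.
move=> n2 t01 Ep Eq Er Es pq rs irr sep F0.
have [[P [Q [Q0 QtP]]]|/irr gap] := pselect (rational_real t); last first.
  exact: (cantor_avoid_irrational t01 Ep Eq Er Es pq rs gap F0).
have u0 : p - q != 0 by rewrite subr_eq0.
have w0 : r - s != 0 by rewrite subr_eq0.
have avoid i f D C c (sf : shift_form i f D C c) :=
  cantor_avoid_shift_form sf Ep Eq Er Es (sep i).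
have [j wj] := row_neq0 w0.
have [t0|tn0] := eqVneq t 0.
  have d0 : dotr (p - q) (r - s) = 0.
    by move/eqP: F0; rewrite /angle_form t0 mul0r subr0 expf_eq0 => /eqP.
  by move/eqP: wj; apply; exact: (avoid _ _ _ _ _ (dotr_shift_form j) d0).
have [t1|tn1] := eqVneq t 1.
  (* A second coordinate exists since n >= 2; the minor in [i] and [j] has derivative [w_j], which
     is nonzero. *)
  have [i ij] : exists i : 'I_n, i != j.
    have [j0|j0] := posnP j.
      by exists (Ordinal n2); rewrite -val_eqE /= j0.
    by exists (Ordinal (ltnW n2)); rewrite -val_eqE /= eq_sym -lt0n.
  rewrite t1 in F0; have [c uc] := dotr_collinear w0 F0.
  move/eqP: wj; apply; apply: (avoid _ _ _ _ _ (minor_shift_form ij)).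
  by rewrite uc !mxE; ring.
have D0 i := avoid _ _ _ _ _ (angle_shift_form i t01 Q0 QtP) F0.
have hi i : dotr (p - q) (r - s) * (r - s) ord0 i =
    t * (dotr (r - s) (r - s) * (p - q) ord0 i).
  by have /eqP := D0 i; rewrite mulf_eq0 pnatr_eq0 /= subr_eq0 => /eqP.
(* If all derivatives vanish then <u, w> w = t |w|^2 u. Pairing with [w] gives (1 - t) <u, w> = 0,
   hence <u, w> = 0, and F_t = - t |u|^2 |w|^2 is nonzero. *)
have uw : dotr (p - q) (r - s) * dotr (r - s) (r - s) =
    t * dotr (r - s) (r - s) * dotr (p - q) (r - s).
  transitivity (\sum_i dotr (p - q) (r - s) * ((r - s) ord0 i * (r - s) ord0 i)).
    by rewrite -mulr_sumr.
  transitivity (\sum_i t * dotr (r - s) (r - s) * ((p - q) ord0 i * (r - s) ord0 i)).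
    by apply: eq_bigr => i _; rewrite mulrA hi; ring.
  by rewrite -mulr_sumr.
rewrite -!dotr_eq0 in u0 w0.
have : (1 - t) * dotr (p - q) (r - s) = 0.
  apply: (mulIf w0); rewrite mul0r.
  by rewrite mulrBl mul1r mulrBl uw; ring.
move=> /eqP; rewrite mulf_eq0 subr_eq0 eq_sym (negbTE tn1) /= => /eqP d0.
move/eqP: F0; rewrite /angle_form d0 expr0n sub0r oppr_eq0 !mulf_eq0.
by rewrite (negbTE tn0) (negbTE u0) (negbTE w0).
Qed.

End avoidance.

(** * Scheduling of the requirements and assembly *)

(* A stage serves either the angle of a given index, without translation, or a
   triple [(l, c, i)]: the points of the sup-norm ball of centre [c / 2 ^ l] and
   radius [2 / 2 ^ l] are then translated along coordinate [i]. *)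
Definition task (n : nat) := (nat + nat * 'rV[int]_n * 'I_n)%type.

(** The first component of the decoded pair is discarded, so that every task recurs infinitely
    often. *)
Definition task_at (n : nat) (k : nat) : option (task n) :=
  omap snd (unpickle k : option (nat * task n)).

Lemma task_at_often (n : nat) (T : task n) K :
  exists2 k, (K <= k)%N & task_at n k = Some T.
Proof.
apply: contrapT => nex.
have lt (j : 'I_K.+1) : (pickle (j : nat, T) < K)%N.
  rewrite ltnNge; apply/negP => Kj; apply: nex; exists (pickle (j : nat, T)) => //.
  by rewrite /task_at pickleK.
have /leq_card : injective (fun j => Ordinal (lt j)).
  by move=> i j /(congr1 val) /(pcan_inj pickleK) [] /val_inj.
by rewrite !card_ord ltnn.
Qed.

Definition task_chi (R : realType) (n k : nat) (X : 'rV[R]_n) : bool :=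
  if task_at n k is Some (inr (l, c, _)) then
    [forall j, `|X ord0 j - (c ord0 j)%:~R / 2 ^+ l| < 2 / 2 ^+ l]
  else false.

Definition task_dir (n : nat) (i0 : 'I_n) (k : nat) : 'I_n :=
  if task_at n k is Some (inr (_, _, i)) then i else i0.

(** [g k L] is to return a scale of at least [L] suited to stage [k]; the values passed for [L] are
    the growth bound, and 1 at the start. *)
Fixpoint scale_seq (g : nat -> nat -> nat) (k : nat) : nat :=
  if k is k'.+1
  then g k (k * (8 * scale_seq g k' + k' + k))%N
  else g 0%N 1%N.

(** [l] is such that each other point is more than 4 / 2^l from [p] in some coordinate. The centre
    is within 2^-l of [p] and grid points within 2^-l of their points, so the radius 2 / 2^l admits
    those of [p] and no others. *)
Lemma task_separates (R : realType) (n : nat) (i0 : 'I_n) (a : nat -> nat)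
    (p q r s : 'rV[R]_n) :
  (forall k, (k <= a k)%N) -> p != q -> p != r -> p != s ->
  forall i K, exists k, [/\ (K <= k)%N, task_dir i0 k = i,
    forall X, near_by (2 ^- a k) p X -> task_chi k X &
    forall x X, x = q \/ x = r \/ x = s -> near_by (2 ^- a k) x X ->
      task_chi k X = false].
Proof.
move=> ak pq pr ps i K.
have sep x : p != x -> exists L, forall l, (L <= l)%N -> exists j,
    4 * 2^-1 ^+ l < `|p ord0 j - x ord0 j|.
  rewrite -subr_eq0 => /row_neq0[j]; rewrite -normr_gt0 !mxE => pj.
  have h01 : 0 <= (2^-1 : R) < 1 by lra.
  have [L hL] := expr_eventually_lt h01 (divr_gt0 pj (ltr0n R 4)).
  exists L => l /hL; rewrite ltr_pdivlMr// => h; exists j.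
  by rewrite mulrC.
have [L1 h1] := sep _ pq; have [L2 h2] := sep _ pr; have [L3 h3] := sep _ ps.
pose l := maxn L1 (maxn L2 L3).
have sepl x : x = q \/ x = r \/ x = s -> exists j,
    4 * 2^-1 ^+ l < `|p ord0 j - x ord0 j|.
  move=> [->|[->|->]]; [apply: h1|apply: h2|apply: h3].
  - exact: leq_maxl.
  - by rewrite /l maxnCA leq_maxl.
  - by rewrite /l maxnA leq_maxr.
pose c : 'rV[int]_n := \row_j Num.floor (2 ^+ l * p ord0 j).
have P0 : 0 < 2 ^+ l :> R by rewrite exprn_gt0.
have pc j : 0 <= p ord0 j - (c ord0 j)%:~R / 2 ^+ l <= 2 ^- l.
  have e : p ord0 j - (c ord0 j)%:~R / 2 ^+ l =
      (2 ^+ l * p ord0 j - (c ord0 j)%:~R) / 2 ^+ l.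
    by field; rewrite gt_eqF.
  have := floor_itv (2 ^+ l * p ord0 j); rewrite /= intrD1 => /andP[f1 f2].
  rewrite e mxE divr_ge0 ?subr_ge0 ?(ltW P0)//= ler_pdivrMr// mulVf ?gt_eqF//.
  by rewrite lerBlDl ltW// addrC.
have [k Kk tk] := task_at_often (inr (l, c, i) : task n) (maxn K l.+1).
move: Kk; rewrite geq_max => /andP[Kk lk].
have al : 2 ^- a k < 2^-1 ^+ l :> R.
  rewrite exprVn ltf_pV2 ?posrE ?exprn_gt0// ltr_eXn2l ?ltr1n//.
  exact: leq_trans lk (ak k).
rewrite exprVn in al; exists k; split=> //; first by rewrite /task_dir tk.
  move=> X pX; rewrite /task_chi tk; apply/forallP => j.
  have := pX j; have := pc j; move: (_%:~R / 2 ^+ l) => z.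
  rewrite ler_norml ltr_norml => /andP[h1' h2'] /andP[h3' h4'].
  lra.
move=> x X /sepl[j hj] xX; rewrite /task_chi tk; apply/negbTE.
rewrite negb_forall; apply/existsP; exists j; rewrite -leNgt.
have := xX j; have := pc j; move: hj; rewrite exprVn; move: (_%:~R / 2 ^+ l) => z.
move=> hj hz hx.
have := ler_distD (X ord0 j) (p ord0 j) (x ord0 j).
rewrite [`|X ord0 j - x ord0 j|]distrC.
have := ler_distD z (p ord0 j) (X ord0 j); rewrite [`|z - _|]distrC.
have : `|p ord0 j - z| <= 2 ^- l by rewrite ler_norml; lra.
lra.
Qed.

Lemma gap_at_often (R : realType) (n : nat) (t : R) (L : nat) : (0 < n)%N ->
  ~ rational_real t -> exists2 a, (L <= a)%N & gap_at n t a.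
Proof.
move=> n0 irr.
have n1 : 1 <= n%:R ^+ 2 :> R by rewrite exprn_ege1// ler1n.
have [|a [La ha]] := @irrational_gap _ t _ L n1; last by exists a.
by move=> p q q0 h; apply: irr; exists p, q.
Qed.

Lemma vectors_form_angleE (R : realType) (n : nat) (u w : 'rV[R]_n) (al : R) :
  u != 0 -> w != 0 -> vectors_form_angle u w al ->
  angle_form (cos al ^+ 2) u w = 0.
Proof.
rewrite -!dotr_eq0 => u0 w0 [_ ->]; rewrite /angle_form /enorm.
rewrite expr_div_n exprMn !sqr_sqrtr ?dotr_ge0//.
by rewrite divfK ?subrr// mulf_neq0.
Qed.

(** Only [p] must differ from the other points: [q] may equal [r] or [s], which covers angles at a
    vertex. *)
Lemma angle_avoiding_set (R : realType) (n : nat) (S : set R) : (2 <= n)%N ->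
  countable S -> exists E : set 'rV[R]_n,
    [/\ compact E, hausdorff_dim E = (n%:R / 8)%:E &
      forall p q r s al, E p -> E q -> E r -> E s ->
        p != q -> p != r -> p != s -> r != s -> S al ->
        ~ vectors_form_angle (p - q) (r - s) al].
Proof.
move=> n2 /countable_injP[f f_inj].
have n0 : (0 < n)%N := ltnW n2.
pose spec k a := forall al, S al -> task_at n k = Some (inl (f al)) ->
  ~ rational_real (cos al ^+ 2) -> gap_at n (cos al ^+ 2) a.
have spec_ex k L : exists a, (L <= a)%N /\ spec k a.
  have [[al [Sal [tal irr]]]|nal] := pselect (exists al, S al /\
      (task_at n k = Some (inl (f al)) /\ ~ rational_real (cos al ^+ 2))).
    (* Injectivity of [f] on [S] leaves at most one angle to serve at each stage. *)
    have [a La ga] := gap_at_often L n0 irr; exists a; split=> // be Sbe.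
    rewrite tal => -[/f_inj]; rewrite !inE => /(_ Sal Sbe) <- _.
    exact: ga.
  exists L; split=> // al Sal tal irr; exfalso; apply: nal.
  by exists al.
have /choice[g hg] := fun kL : nat * nat => spec_ex kL.1 kL.2.
pose a := scale_seq (fun k L => g (k, L)).
have a_gt0 : (0 < a 0)%N by have [] := hg (0%N, 1%N).
have a_growth k : (k.+1 * (box_exponent a k + k.+1) <= a k.+1)%N.
  by have [] := hg (k.+1, (k.+1 * (8 * a k + k + k.+1))%N).
have a_spec k : spec k (a k).
  case: k => [|k]; first by have [] := hg (0%N, 1%N).
  by have [] := hg (k.+1, (k.+1 * (8 * a k + k + k.+1))%N).
pose i0 := Ordinal n0.
exists (cantor_set a (@task_chi R n) (task_dir i0)); split.
- exact: compact_cantor_set.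
- exact: hausdorff_dim_cantor.
move=> p q r s al Ep Eq Er Es pq pr ps rs Sal ang.
have u0 : p - q != 0 by rewrite subr_eq0.
have w0 : r - s != 0 by rewrite subr_eq0.
have t01 : 0 <= cos al ^+ 2 <= 1.
  by rewrite sqr_ge0 /= -(cos2Dsin2 al) lerDl sqr_ge0.
apply: (cantor_avoid_angle a_gt0 a_growth n2 t01 Ep Eq Er Es pq rs).
- move=> irr K; have [k Kk tk] := task_at_often (inl (f al) : task n) K.
  exists k; split=> // [X|]; first by rewrite /task_chi tk.
  exact: a_spec.
- apply: task_separates => // k; exact: a_ge_id.
- exact: vectors_form_angleE ang.
Qed.

Unset Implicit Arguments.

Theorem theorem3p4 (R : realType) (n : nat) (hn : (2 <= n)%N) (S : set R)
    (hS : S `<=` [set a | 0 <= a <= pi]) (hcount : countable S) :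
  exists E : set 'rV[R]_n,
    [/\ compact E,
        hausdorff_dim E = (n%:R / 8)%:E,
        ~ (exists x y z a,
             [/\ E x, E y, E z & uniq [:: x; y; z]] /\
             S a /\ points_form_angle x y z a) &
        ~ (exists x y z v a,
             [/\ E x, E y, E z, E v & uniq [:: x; y; z; v]] /\
             S a /\ vectors_form_angle (x - y) (z - v) a)].
Proof.
have [E [cE dE avoid]] := angle_avoiding_set hn hcount.
exists E; split=> // [[x [y [z [al [[Ex Ey Ez]]]]]]|[x [y [z [v [al [[Ex Ey Ez Ev]]]]]]]].
- rewrite /= !inE !negb_or !andbT => /andP[/andP[xy xz] yz] [Sal].
  have [yx zx zy] : [/\ y != x, z != x & z != y] by split; rewrite eq_sym.
  (* In each alternative the vertex is taken for both [q] and [s]. *)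
  by case; exact: avoid.
- rewrite /= !inE !negb_or !andbT => /andP[/and3P[xy xz xv] /andP[_ zv]] [Sal].
  exact: avoid.
Qed.
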